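(* Let $\{\lambda_n\}_{n\geq 0}\subset(0,1)$ satisfy $\lambda_n<\lambda_{n+1}$ for all $n$ and the Carleson condition: there exists $\delta>0$ such that $|B_n(\lambda_n)|\geq\delta$ for every $n$. Let $\mathcal H_0$ be a Hilbert space and $\{x_n\}_{n\geq 0}\subset\mathcal H_0$ a family such that every finite subfamily is linearly independent, $\mathcal H_0=\bigvee_{n\geq 0}x_n$, $\inf_{n\geq 0}\|x_n\|>0$, the mappings $\mathcal P_n$ given on finite linear combinations by $\mathcal P_n\sum_k a_kx_k=\sum_{k=0}^n a_kx_k$ extend to bounded operators on $\mathcal H_0$ with $\sup_{n\geq 0}\|\mathcal P_n\|<\infty$, and there is a (bounded linear) transformation $W\colon\mathcal K_B\to\mathcal H_0$ with $Wu_n=x_n$ for all $n\geq 0$. Suppose that $\{x_n\}_{n\geq 0}$ is not a Riesz basis of $\mathcal H_0$. Let $g\in H^\infty$ be an outer function with $\sum_{n\geq 0}|g(\lambda_n)|^2<\infty$. Let $R_0\colon\mathcal H_0\to\mathcal H_0$ be the bounded operator with $R_0x_n=\lambda_nx_n$, $n\geq 0$, and define $$T\colon BH^2\oplus\mathcal H_0\to BH^2\oplus\mathcal H_0,\qquad T=\begin{pmatrix}S|_{BH^2} & P_{BH^2}S|_{\mathcal K_B}W^*\\ 0 & R_0^*\end{pmatrix}.$$ Then there exists a closed invariant subspace $\mathcal M$ of $T$ such that $T|_{\mathcal M}\approx S$ and $$(BH^2\oplus\{0\})\vee\mathcal M=BH^2\oplus\mathcal H_0.$$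
   Context: Hilbert spaces are complex and separable; ''operator'' and ''transformation'' mean bounded linear map; $\bigvee$ and $\vee$ denote closed linear span. $\mathbb D$ is the open unit disc, $H^2$ the Hardy space on $\mathbb D$, $H^\infty$ the algebra of bounded analytic functions on $\mathbb D$, $S\colon H^2\to H^2$, $(Sh)(z)=zh(z)$, the unilateral shift of multiplicity 1, and $h_\lambda(z)=\frac{1}{1-\overline\lambda z}$ for $z,\lambda\in\mathbb D$. $P_{\mathcal M}$ is the orthogonal projection onto $\mathcal M$. For $\lambda\in\mathbb D$, $b_\lambda(z)=\frac{|\lambda|}{\lambda}\frac{\lambda-z}{1-\overline\lambda z}$ is the Blaschke factor; $B=\prod_n b_{\lambda_n}$ is the Blaschke product with zeros $\lambda_n$ (it converges under the Carleson condition), $B_n=\prod_{k\neq n}b_{\lambda_k}$, $\mathcal K_B=H^2\ominus BH^2$, and $u_n=(1-|\lambda_n|^2)^{1/2}h_{\lambda_n}$, which under the Carleson condition form a Riesz basis of $\mathcal K_B$. A family $\{x_n\}_{n\ge0}$ is a Riesz basis of $\mathcal H_0$ if the mapping sending some orthonormal basis $\{e_n\}$ to $\{x_n\}$ ($e_n\mapsto x_n$) is an invertible bounded transformation onto $\mathcal H_0$. Under the stated assumptions the map $R_0$ given on the $x_n$ does extend to a bounded operator. $A\approx R$ (similarity) means that there is a bounded transformation $V$ with bounded inverse such that $VA=RV$. *)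

(* Defs.v *)
From HB Require Import structures.
From mathcomp Require Import all_boot all_order all_algebra.
From mathcomp Require Import complex ring lra.
From mathcomp Require Import all_classical all_reals all_analysis.

Set Implicit Arguments.
Unset Strict Implicit.
Unset Printing Implicit Defensive.

Import Order.TTheory GRing.Theory Num.Theory ComplexField.Normc.
Import numFieldNormedType.Exports.

Local Open Scope classical_set_scope.
Local Open Scope complex_scope.
Local Open Scope ring_scope.

(* The topology of R[i]: the one defined by its modulus. *)
HB.instance Definition _ (R : realType) := NormedModule.copy R[i] R[i]^o.

(* The inner product is linear in its first argument. *)
HB.mixin Record CompleteNormedModule_isHilbert (R : realType) H
    & CompleteNormedModule R[i] H := {
  hdot : H -> H -> R[i] ;
  hdotPl : forall (a : R[i]) (x y z : H),
    hdot (a *: x + y) z = a * hdot x z + hdot y z ;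
  hdotC : forall x y : H, hdot y x = (hdot x y)^*%C ;
  hdotxx : forall x : H, hdot x x = `|x| ^+ 2
}.

#[short(type="hilbertType")]
HB.structure Definition Hilbert (R : realType) :=
  {H of CompleteNormedModule R[i] H & CompleteNormedModule_isHilbert R H}.

Section Subspaces.
Context {R : realType}.

Definition subspace_set (V : lmodType R[i]) (M : set V) : Prop :=
  M 0 /\ forall (a : R[i]) (x y : V), M x -> M y -> M (a *: x + y).

Definition linear_span (V : lmodType R[i]) (X : set V) : set V :=
  [set v | exists n (a : 'I_n -> R[i]) (y : 'I_n -> V),
     (forall i, X (y i)) /\ v = \sum_i a i *: y i].

Definition closed_span (V : normedModType R[i]) (X : set V) : set V :=
  closure (linear_span X).

(* An operator with domain a subspace D of V is a function on V of which only
   the values on D matter. *)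
Definition bounded_linear_on (V W : normedModType R[i]) (D : set V)
    (f : V -> W) : Prop :=
  (forall (a : R[i]) (x y : V), D x -> D y -> f (a *: x + y) = a *: f x + f y) /\
  (exists C : R, forall x, D x -> `|f x| <= C%:C * `|x|).

(* A|M and B|N are similar, where A maps M to M and B maps N to N. *)
Definition similar_on (V W : normedModType R[i])
    (M : set V) (A : V -> V) (N : set W) (B : W -> W) : Prop :=
  exists (X : V -> W) (Y : W -> V),
    [/\ bounded_linear_on M X /\ (forall v, M v -> N (X v)),
        bounded_linear_on N Y /\ (forall w, N w -> M (Y w)),
        (forall v, M v -> Y (X v) = v),
        (forall w, N w -> X (Y w) = w)
      & (forall v, M v -> X (A v) = B (X v))].

End Subspaces.

Section Hilbert.
Context {R : realType}.

Definition orthocompl (H : hilbertType R) (K : set H) : set H :=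
  [set x | forall y, K y -> hdot x y = 0].

Definition orthoproj (H : hilbertType R) (K : set H) (x : H) : H :=
  xget 0 [set y | K y /\ orthocompl K (x - y)].

(* The adjoint H2 -> D of an operator D -> H2, D a closed subspace of H1. *)
Definition adjoint_on (H1 H2 : hilbertType R) (D : set H1) (f : H1 -> H2)
    (y : H2) : H1 :=
  xget 0 [set z | D z /\ forall x, D x -> hdot (f x) y = hdot x z].

Definition orthonormal_basis (H : hilbertType R) (e : nat -> H) : Prop :=
  (forall m n, hdot (e m) (e n) = (m == n)%:R) /\
  closed_span (range e) = setT.

Definition riesz_basis (H : hilbertType R) (x : nat -> H) : Prop :=
  exists (E : hilbertType R) (e : nat -> E) (V : E -> H) (Vinv : H -> E),
    [/\ orthonormal_basis e,
        bounded_linear_on setT V, bounded_linear_on setT Vinv,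
        cancel V Vinv /\ cancel Vinv V
      & forall n, V (e n) = x n].

End Hilbert.

Section SquareSummable.
Context {R : realType}.
Implicit Types (a b : nat -> R[i]) (z : R[i]).

Definition square_summable a : Prop := cvgn (series (fun n => normc (a n) ^+ 2)).

Definition l2_pred : {pred nat -> R[i]} := fun a => `[< square_summable a >].

Let normcE z : `|z| = (normc z)%:C.
Proof. by case: z. Qed.

Lemma normc_ge0 z : 0 <= normc z.
Proof. by case: z => x y; exact: sqrtr_ge0. Qed.

Lemma cvg_complex (u : nat -> R[i]) (l : R[i]) :
  (u @ \oo --> l) <->
  ((fun n => complex.Re (u n)) @ \oo --> complex.Re l /\
   (fun n => complex.Im (u n)) @ \oo --> complex.Im l).
Proof.
have ReB (x y : R[i]) : complex.Re (x - y) = complex.Re x - complex.Re y.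
  by case: x y => [? ?] [? ?].
have ImB (x y : R[i]) : complex.Im (x - y) = complex.Im x - complex.Im y.
  by case: x y => [? ?] [? ?].
split=> [/cvgrPdist_lt ul|[/cvgrPdist_lt ur /cvgrPdist_lt ui]].
  split; apply/cvgrPdist_lt => e e0.
  - have := ul e%:C; rewrite ltcR => /(_ e0); apply: filterS => n.
    rewrite -ReB normcE ltcR; apply: le_lt_trans.
    by case: (l - u n) => x y /=; rewrite -sqrtr_sqr ler_wsqrtr// lerDl sqr_ge0.
  - have := ul e%:C; rewrite ltcR => /(_ e0); apply: filterS => n.
    rewrite -ImB normcE ltcR; apply: le_lt_trans.
    by case: (l - u n) => x y /=; rewrite -sqrtr_sqr ler_wsqrtr// lerDr sqr_ge0.
apply/cvgrPdist_lt => e e0.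
have {e0}[d -> d0] : exists2 d : R, e = d%:C & 0 < d.
  case: e e0 => x y; rewrite ltcE /= => /andP[/eqP -> x0].
  by exists x.
have d2 : 0 < d / 2 by rewrite divr_gt0.
move: (ur _ d2) (ui _ d2); apply: filterS2 => n.
rewrite -ReB -ImB normcE ltcR.
case: (l - u n) => x y /= xd yd.
have xy : x ^+ 2 + y ^+ 2 < d ^+ 2.
  rewrite -[x ^+ 2]real_normK ?num_real// -[y ^+ 2]real_normK ?num_real//.
  have := normr_ge0 x; have := normr_ge0 y; nra.
rewrite -(ger0_norm (ltW d0)) -sqrtr_sqr ltr_sqrt//.
by rewrite exprn_gt0.
Qed.

Let psum a := series (fun n => normc (a n) ^+ 2).

Let psum_ge0 a N : 0 <= psum a N.
Proof. by apply: sumr_ge0 => i _; rewrite sqr_ge0. Qed.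

Let psum_homo a : {homo psum a : m n / (m <= n)%N >-> m <= n}.
Proof. by apply/nondecreasing_seqP => n; rewrite /psum seriesSr lerDl sqr_ge0.
Qed.

Lemma square_summableP a :
  square_summable a <-> exists C, forall N, series (fun n => normc (a n) ^+ 2) N <= C.
Proof.
split=> [a2|[C aC]].
  exists (limn (psum a)) => N.
  exact: (nondecreasing_cvgn_le (@psum_homo a)).
apply: nondecreasing_is_cvgn; first exact: psum_homo.
by exists C => _ [N _ <-].
Qed.

Definition l2_sqnorm a : R := limn (series (fun n => normc (a n) ^+ 2)).

Lemma l2_sqnorm_ub a N : square_summable a ->
  series (fun n => normc (a n) ^+ 2) N <= l2_sqnorm a.
Proof. by move=> a2; exact: (nondecreasing_cvgn_le (@psum_homo a)). Qed.

Lemma l2_sqnorm_le a C :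
  (forall N, series (fun n => normc (a n) ^+ 2) N <= C) -> l2_sqnorm a <= C.
Proof.
move=> aC; apply: limr_le; last by apply: nearW.
by apply/square_summableP; exists C.
Qed.

Lemma l2_sqnorm_ge0 a : square_summable a -> 0 <= l2_sqnorm a.
Proof. by move=> a2; apply: le_trans (psum_ge0 a 0) (l2_sqnorm_ub 0 a2). Qed.

Lemma sum_cauchy_schwarz (x y : nat -> R) N :
  (\sum_(0 <= n < N) x n * y n) ^+ 2 <=
  (\sum_(0 <= n < N) x n ^+ 2) * (\sum_(0 <= n < N) y n ^+ 2).
Proof.
set P := \sum_(_ <= _ < _) _ * _; set X := \sum_(_ <= _ < _) x _ ^+ 2.
set Y := \sum_(_ <= _ < _) y _ ^+ 2.
have Y0 : 0 <= Y by apply: sumr_ge0 => i _; rewrite sqr_ge0.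
have : 0 <= Y * (X * Y - P ^+ 2).
  have -> : Y * (X * Y - P ^+ 2) = \sum_(0 <= n < N) (Y * x n - P * y n) ^+ 2.
    rewrite [RHS](eq_bigr (fun n => Y ^+ 2 * x n ^+ 2 -
      (Y * P *+ 2) * (x n * y n) + P ^+ 2 * y n ^+ 2)); last by move=> n _; ring.
    rewrite big_split /= sumrB -!mulr_sumr -/X -/Y -/P; ring.
  by apply: sumr_ge0 => i _; rewrite sqr_ge0.
have [Y0'|Yneq0] := eqVneq Y 0; last first.
  by rewrite pmulr_rge0 ?subr_ge0// lt_def Yneq0.
move=> _; suff -> : P = 0 by rewrite expr0n /= Y0' mulr0.
have /psumr_eq0P y0 : \sum_(n < N) y n ^+ 2 = 0 by rewrite -[RHS]Y0' /Y big_mkord.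
rewrite /P big_mkord big1// => i _.
by have /eqP := y0 (fun i _ => sqr_ge0 _) i isT; rewrite sqrf_eq0 => /eqP ->; rewrite mulr0.
Qed.

Lemma l2_sqnormD a b : square_summable a -> square_summable b ->
  square_summable (fun n => a n + b n) /\
  Num.sqrt (l2_sqnorm (fun n => a n + b n)) <=
  Num.sqrt (l2_sqnorm a) + Num.sqrt (l2_sqnorm b).
Proof.
move=> a2 b2; set A := l2_sqnorm a; set B := l2_sqnorm b.
have A0 : 0 <= A by exact: l2_sqnorm_ge0.
have B0 : 0 <= B by exact: l2_sqnorm_ge0.
have H N : psum (fun n => a n + b n) N <= (Num.sqrt A + Num.sqrt B) ^+ 2.
  have aN := l2_sqnorm_ub N a2; have bN := l2_sqnorm_ub N b2.
  pose P := \sum_(0 <= n < N) normc (a n) * normc (b n).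
  have HP : P ^+ 2 <= psum a N * psum b N by exact: sum_cauchy_schwarz.
  have HP' : P <= Num.sqrt A * Num.sqrt B.
    apply: le_trans (ler_norm _) _; rewrite -sqrtr_sqr -sqrtrM//.
    by apply: ler_wsqrtr; apply: le_trans HP _; apply: ler_pM => //; exact: psum_ge0.
  have : psum (fun n => a n + b n) N <= psum a N + psum b N + 2 * P.
    rewrite /psum /series /= /P mulr_sumr -!big_split /=.
    apply: ler_sum => i _.
    rewrite (_ : _ + _ = (normc (a i) + normc (b i)) ^+ 2); last by ring.
    by rewrite ler_sqr ?nnegrE ?addr_ge0 ?normc_ge0 ?le_normcD.
  move=> /le_trans; apply.
  rewrite sqrrD !sqr_sqrtr//; move: aN bN HP'; rewrite -/A -/B -/(psum a) -/(psum b).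
  lra.
split; first by apply/square_summableP; eexists; exact: H.
rewrite -[leRHS]ger0_norm ?addr_ge0 ?sqrtr_ge0// -sqrtr_sqr.
by apply: ler_wsqrtr; exact: l2_sqnorm_le.
Qed.

Lemma square_summableZ c a : square_summable a -> square_summable (fun n => c * a n).
Proof.
move=> a2; apply/square_summableP; exists (normc c ^+ 2 * l2_sqnorm a) => N.
rewrite /series /= (eq_bigr (fun n => normc c ^+ 2 * normc (a n) ^+ 2)); last first.
  by move=> n _; rewrite normcM exprMn.
by rewrite -mulr_sumr ler_wpM2l ?sqr_ge0// l2_sqnorm_ub.
Qed.

Lemma square_summable0 : square_summable (fun=> 0).
Proof.
apply/square_summableP; exists 0 => N.
by rewrite /series /= big1// => i _; rewrite expr0n /= addr0 sqrtr0 expr0n.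
Qed.

Lemma l2_submod : submod_closed l2_pred.
Proof.
split; first by apply/asboolP; exact: square_summable0.
move=> c a b /asboolP a2 /asboolP b2; apply/asboolP.
by have [] := l2_sqnormD (@square_summableZ c a a2) b2.
Qed.

Lemma l2_dot_cvg a b : square_summable a -> square_summable b ->
  cvgn (series (fun n => a n * (b n)^*%C)).
Proof.
move=> a2 b2.
have H (f : nat -> R) : (forall n, `|f n| <= normc (a n) * normc (b n)) -> cvgn (series f).
  move=> fab; apply: normed_cvg.
  apply: nondecreasing_is_cvgn.
    apply: (@nondecreasing_series _ _ xpredT 0) => n _ _; exact: normr_ge0.
  exists (l2_sqnorm a + l2_sqnorm b) => _ [N _ <-].
  apply: le_trans (lerD (l2_sqnorm_ub N a2) (l2_sqnorm_ub N b2)).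
  rewrite /series /= -big_split /=; apply: ler_sum => i _.
  apply: le_trans (fab i) _.
  have := sqr_ge0 (normc (a i) - normc (b i)).
  have := normc_ge0 (a i); have := normc_ge0 (b i); nra.
have nab n : normc (a n * (b n)^*%C) = normc (a n) * normc (b n).
  by rewrite normcM; congr (_ * _); case: (b n) => x y /=; rewrite sqrrN.
have cre : cvgn (series (fun n => complex.Re (a n * (b n)^*%C))).
  apply: H => n; rewrite -nab; case: (_ * _) => x y /=.
  by rewrite -sqrtr_sqr ler_wsqrtr// lerDl sqr_ge0.
have cim : cvgn (series (fun n => complex.Im (a n * (b n)^*%C))).
  apply: H => n; rewrite -nab; case: (_ * _) => x y /=.
  by rewrite -sqrtr_sqr ler_wsqrtr// lerDr sqr_ge0.
apply/cvg_ex; exists (Complex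
  (limn (series (fun n => complex.Re (a n * (b n)^*%C))))
  (limn (series (fun n => complex.Im (a n * (b n)^*%C))))).
have ReE (u : nat -> R[i]) : series (fun n => complex.Re (u n)) =
    (fun N => complex.Re (series u N)).
  by apply/funext => N; rewrite /series /=; apply/esym; apply: (big_morph (@complex.Re R)) => // -[? ?] [? ?].
have ImE (u : nat -> R[i]) : series (fun n => complex.Im (u n)) =
    (fun N => complex.Im (series u N)).
  by apply/funext => N; rewrite /series /=; apply/esym; apply: (big_morph (@complex.Im R)) => // -[? ?] [? ?].
by apply/cvg_complex; split; rewrite /= -?ReE -?ImE.
Qed.

End SquareSummable.

(* The Hardy space H^2: the functions f z = \sum_n a_n z ^+ n on the disc with
   \sum_n |a_n| ^+ 2 finite, identified with their Taylor coefficients. *)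
Record hardy (R : realType) :=
  Hardy { hcoef : nat -> R[i] ; _ : hcoef \in @l2_pred R }.

HB.instance Definition _ (R : realType) := [isSub for @hcoef R].
HB.instance Definition _ (R : realType) := [Choice of hardy R by <:].
HB.instance Definition _ (R : realType) :=
  GRing.isSubmodClosed.Build R[i] (nat -> R[i]) (@l2_pred R) (@l2_submod R).
HB.instance Definition _ (R : realType) :=
  [SubChoice_isSubLmodule of hardy R by <:].

Section HardyHilbert.
Context {R : realType}.
Implicit Types (h k : hardy R) (z : R[i]).

Lemma hcoefP h : square_summable (hcoef h).
Proof. by case: h => a /= /asboolP. Qed.
Arguments hcoefP : clear implicits.

Definition hardy_norm h : R[i] := (Num.sqrt (l2_sqnorm (hcoef h)))%:C.

Definition hardy_dot h k : R[i] :=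
  limn (series (fun n => hcoef h n * (hcoef k n)^*%C)).

Lemma hcoefD h k n : hcoef (h + k) n = hcoef h n + hcoef k n.
Proof. by []. Qed.

Lemma hcoefZ a h n : hcoef (a *: h) n = a * hcoef h n.
Proof. by []. Qed.

Lemma hcoefN h n : hcoef (- h) n = - hcoef h n.
Proof. by []. Qed.

Lemma hcoef_le h n : normc (hcoef h n) <= Num.sqrt (l2_sqnorm (hcoef h)).
Proof.
rewrite -[leLHS]ger0_norm ?normc_ge0// -sqrtr_sqr; apply: ler_wsqrtr.
apply: le_trans (l2_sqnorm_ub n.+1 (hcoefP h)).
by rewrite /series /= big_nat_recr //= lerDr; apply: sumr_ge0 => i _; rewrite sqr_ge0.
Qed.

Let hardy_normD h k : hardy_norm (h + k) <= hardy_norm h + hardy_norm k.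
Proof.
rewrite /hardy_norm -rmorphD /= lecR.
by have [] := l2_sqnormD (hcoefP h) (hcoefP k).
Qed.

Let hardy_normZ a h : hardy_norm (a *: h) = `|a| * hardy_norm h.
Proof.
have -> : `|a| = (normc a)%:C by case: a.
rewrite /hardy_norm -rmorphM /=; congr (_%:C).
rewrite -[normc a]ger0_norm ?normc_ge0// -sqrtr_sqr -sqrtrM ?sqr_ge0//; congr Num.sqrt.
rewrite /l2_sqnorm; apply: cvg_lim => //.
rewrite (_ : series _ = fun N => normc a ^+ 2 * series (fun n => normc (hcoef h n) ^+ 2) N).
  by apply: cvgM; [exact: cvg_cst | exact: hcoefP].
apply/funext => N; rewrite /series /= mulr_sumr.
by apply: eq_bigr => i _; rewrite normcM exprMn.
Qed.

Let hardy_norm0 h : hardy_norm h = 0 -> h = 0.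
Proof.
move=> /complexI h0; apply/val_inj/funext => n /=; apply: eq0_normc.
by apply/eqP; rewrite eq_le normc_ge0 -[X in _ <= X]h0 hcoef_le.
Qed.

HB.instance Definition _ := Lmodule_isNormed.Build R[i] (hardy R)
  hardy_normD hardy_normZ hardy_norm0.

Lemma hardy_normE h : `|h| = (Num.sqrt (l2_sqnorm (hcoef h)))%:C.
Proof. by []. Qed.


Lemma hardy_norm_lt h (e : R) : 0 < e ->
  (`|h| < e%:C) = (l2_sqnorm (hcoef h) < e ^+ 2).
Proof.
move=> e0; rewrite hardy_normE ltcR -[X in _ < X](ger0_norm (ltW e0)) -sqrtr_sqr.
by rewrite ltr_sqrt ?exprn_gt0.
Qed.

Lemma hardy_complete (F : set_system (hardy R)) : ProperFilter F -> cauchy F -> cvg F.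
Proof.
move=> FF Fc.
have Fball (e : R) : 0 < e ->
    exists2 A, F A & forall x y, A x -> A y -> l2_sqnorm (hcoef (x - y)) < e ^+ 2.
  move=> e0; have /cauchy_ballP /(_ e%:C) := Fc.
  rewrite ltcR => /(_ e0) [[A B] /= [FA FB]] AB.
  exists (A `&` B); first exact: filterI.
  move=> x y [Ax _] [_ By]; rewrite -[_ - _]/(hcoef (x - y)) -hardy_norm_lt//.
  by have := AB (x, y) (conj Ax By); rewrite /= -ball_normE.
have coef_cvg (f : R[i] -> R) (n : nat) : (forall z w, f (z - w) = f z - f w) ->
    (forall z, `|f z| <= normc z) -> cvg ((fun x : hardy R => f (hcoef x n)) @ F).
  move=> fB fle; apply: cauchy_cvg; apply/cauchy_ballP => e e0.
  have [A FA AP] := Fball _ e0.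
  exists ((fun x : hardy R => f (hcoef x n)) @` A, (fun x : hardy R => f (hcoef x n)) @` A).
    by split; apply: (@filterS _ F _ A) => // x Ax; exists x.
  move=> [_ _] /= [[x Ax <-] [y Ay <-]]; rewrite /ball /= -fB.
  apply: le_lt_trans (fle _) _; apply: le_lt_trans (hcoef_le (x - y) n) _.
  rewrite -[X in _ < X](ger0_norm (ltW e0)) -sqrtr_sqr ltr_sqrt ?exprn_gt0//.
  exact: AP.
have re_cvg n := coef_cvg (@complex.Re R) n.
have im_cvg n := coef_cvg (@complex.Im R) n.
have {}re_cvg n : cvg ((fun x : hardy R => complex.Re (hcoef x n)) @ F).
  apply: re_cvg => [[? ?] [? ?]//|[x y]] /=.
  by rewrite -sqrtr_sqr ler_wsqrtr// lerDl sqr_ge0.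
have {}im_cvg n : cvg ((fun x : hardy R => complex.Im (hcoef x n)) @ F).
  apply: im_cvg => [[? ?] [? ?]//|[x y]] /=.
  by rewrite -sqrtr_sqr ler_wsqrtr// lerDr sqr_ge0.
pose a n : R[i] := Complex (lim ((fun x : hardy R => complex.Re (hcoef x n)) @ F))
                    (lim ((fun x : hardy R => complex.Im (hcoef x n)) @ F)).
have near_a (e : R) : 0 < e -> exists2 A, F A & forall x, A x ->
    forall N, series (fun n => normc (hcoef x n - a n) ^+ 2) N <= e ^+ 2.
  move=> e0; have [A FA AP] := Fball _ e0; exists A => // x Ax N.
  have sqE (z : R[i]) : normc z ^+ 2 = complex.Re z ^+ 2 + complex.Im z ^+ 2.
    by case: z => u v; rewrite sqr_sqrtr// addr_ge0 ?sqr_ge0.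
  have sqBE (z w : R[i]) : normc (z - w) ^+ 2 =
      (complex.Re z - complex.Re w) ^+ 2 + (complex.Im z - complex.Im w) ^+ 2.
    by rewrite sqE; case: z w => [? ?] [? ?].
  have H : (fun y : hardy R => series (fun n => normc (hcoef x n - hcoef y n) ^+ 2) N) @ F
      --> series (fun n => normc (hcoef x n - a n) ^+ 2) N.
    elim: N => [|N IH].
      rewrite [series _ 0]big_geq// (_ : (fun y => _) = fun=> 0); first exact: cvg_cst.
      by apply/funext => y; rewrite [series _ 0]big_geq//.
    rewrite seriesSr (_ : (fun y => _) = (fun y : hardy R =>
       series (fun n => normc (hcoef x n - hcoef y n) ^+ 2) N +
       ((complex.Re (hcoef x N) - complex.Re (hcoef y N)) ^+ 2 +
       (complex.Im (hcoef x N) - complex.Im (hcoef y N)) ^+ 2))); last first.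
      by apply/funext => y; rewrite seriesSr sqBE.
    rewrite sqBE; apply: cvgD => //.
    by apply: cvgD; rewrite !expr2; apply: cvgM; apply: cvgB;
      first [exact: cvg_cst | exact: re_cvg | exact: im_cvg].
  apply: (cvgr_to_le H); apply: filterS FA => y Ay.
  apply: le_trans (ltW (AP x y Ax Ay)).
  exact: (l2_sqnorm_ub N (hcoefP (x - y))).
have a2 : a \in @l2_pred R.
  have [A FA AP] := near_a _ ltr01.
  have [x Ax] := filter_ex FA.
  have xa : square_summable (fun n => (-1) * (hcoef x n - a n)).
    by apply: square_summableZ; apply/square_summableP; eexists; exact: (AP x Ax).
  have [xa2 _] := l2_sqnormD xa (hcoefP x).
  apply/asboolP; rewrite (_ : a = (fun n => -1 * (hcoef x n - a n) + hcoef x n))//.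
  by apply/funext => n; ring.
apply/cvg_ex; exists (Hardy a2); apply/cvgrPdist_lt => e.
case: e => e e'; rewrite ltcE /= => /andP[/eqP -> e0].
have e20 : 0 < e / 2 by rewrite divr_gt0.
have [A FA AP] := near_a _ e20; apply: filterS FA => x Ax.
rewrite distrC hardy_norm_lt//.
apply: le_lt_trans (_ : (e / 2) ^+ 2 < _); last by rewrite expr_div_n; nra.
by apply: l2_sqnorm_le => N; exact: AP.
Qed.

HB.instance Definition _ := Uniform_isComplete.Build (hardy R) hardy_complete.

Let hardy_dotPl a h1 h2 k :
  hardy_dot (a *: h1 + h2) k = a * hardy_dot h1 k + hardy_dot h2 k.
Proof.
apply: cvg_lim => //.
rewrite (_ : series _ = fun N => a * series (fun n => hcoef h1 n * (hcoef k n)^*%C) N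
   + series (fun n => hcoef h2 n * (hcoef k n)^*%C) N).
  apply: cvgD; last exact: (l2_dot_cvg (hcoefP h2) (hcoefP k)).
  by apply: cvgM; [exact: cvg_cst | exact: (l2_dot_cvg (hcoefP h1) (hcoefP k))].
apply/funext => N; rewrite /series /= mulr_sumr -big_split /=.
by apply: eq_bigr => n _; rewrite mulrDl mulrA.
Qed.

Let hardy_dotC h k : hardy_dot k h = (hardy_dot h k)^*%C.
Proof.
have /cvg_complex [/= cr ci] := l2_dot_cvg (hcoefP h) (hcoefP k).
apply: cvg_lim => //; apply/cvg_complex.
have E N : series (fun n => hcoef k n * (hcoef h n)^*%C) N =
    (series (fun n => hcoef h n * (hcoef k n)^*%C) N)^*%C.
  rewrite /series /= rmorph_sum /=; apply: eq_bigr => n _.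
  by rewrite rmorphM /= conjcK mulrC.
split.
  rewrite (_ : (fun N => _) = fun N =>
    complex.Re (series (fun n => hcoef h n * (hcoef k n)^*%C) N)).
    by rewrite [X in _ --> X](_ : _ = complex.Re (hardy_dot h k))//; case: hardy_dot.
  by apply/funext => N; rewrite E; case: (series _ _).
rewrite (_ : (fun N => _) = fun N =>
    - complex.Im (series (fun n => hcoef h n * (hcoef k n)^*%C) N)).
  rewrite [X in _ --> X](_ : _ = - complex.Im (hardy_dot h k)); last by case: hardy_dot.
  exact: cvgN.
by apply/funext => N; rewrite E; case: (series _ _).
Qed.

Let hardy_dotxx h : hardy_dot h h = `|h| ^+ 2.
Proof.
rewrite hardy_normE -rmorphXn /= sqr_sqrtr ?l2_sqnorm_ge0//; last exact: hcoefP.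
apply: cvg_lim => //; apply/cvg_complex.
have E N : series (fun n => hcoef h n * (hcoef h n)^*%C) N =
    (series (fun n => normc (hcoef h n) ^+ 2) N)%:C.
  rewrite /series /= rmorph_sum /=; apply: eq_bigr => n _.
  by rewrite -sqr_normc rmorphXn.
split.
  rewrite (_ : (fun N => _) = series (fun n => normc (hcoef h n) ^+ 2)).
    exact: hcoefP.
  by apply/funext => N; rewrite E.
rewrite (_ : (fun N => _) = fun=> 0); first exact: cvg_cst.
by apply/funext => N; rewrite E.
Qed.

HB.instance Definition _ :=
  CompleteNormedModule_isHilbert.Build R (hardy R) hardy_dotPl hardy_dotC hardy_dotxx.

End HardyHilbert.
Arguments hcoefP {R} h.

Section Disc.
Context {R : realType}.
Implicit Types (h : hardy R) (z w l : R[i]).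

(* The element of H^2 with the given Taylor coefficients, when they are square
   summable, and 0 otherwise. *)
Definition hardy_of_coef (a : nat -> R[i]) : hardy R := insubd (0 : hardy R) a.

Lemma hardy_of_coefE a : square_summable a -> hcoef (hardy_of_coef a) = a.
Proof. by move=> a2; rewrite /hardy_of_coef -[LHS]/(val _) insubdK//; apply/asboolP. Qed.

Definition hardy_val h z : R[i] := limn (series (fun n => hcoef h n * z ^+ n)).
Coercion hardy_val : hardy >-> Funclass.

Definition hardy_shift h : hardy R :=
  hardy_of_coef (fun n => if n is m.+1 then hcoef h m else 0).

Definition szego l : hardy R := hardy_of_coef (fun n => (l^*%C) ^+ n).

Lemma geometric_square_summable l : `|l| < 1 -> square_summable (fun n => l ^+ n).
Proof.
have -> : `|l| = (normc l)%:C by case: l.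
rewrite -[1]/(1%:C) ltcR => l1.
have nX n : normc (l ^+ n) = normc l ^+ n.
  by elim: n => [|n IH]; rewrite ?expr0 ?normc1// !exprS normcM IH.
rewrite /square_summable (_ : series _ = series (geometric 1 (normc l ^+ 2))).
  apply: cvgP; apply: cvg_geometric_series.
  by rewrite ger0_norm ?sqr_ge0// expr_lt1 ?normc_ge0.
apply/funext => N; rewrite /series /=; apply: eq_bigr => n _.
by rewrite nX mul1r -!exprM mulnC.
Qed.

Lemma normcJ_lt1 l : `|l| < 1 -> `|l^*%C| < 1.
Proof. by rewrite normcJ. Qed.

Lemma hardy_val_cvg h z : `|z| < 1 -> series (fun n => hcoef h n * z ^+ n) @ \oo --> h z.
Proof.
move=> z1; have := l2_dot_cvg (hcoefP h) (geometric_square_summable (normcJ_lt1 z1)).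
by under eq_fun do rewrite rmorphXn /= conjcK.
Qed.

Lemma hardy_shift_coef h : hcoef (hardy_shift h) = fun n => if n is m.+1 then hcoef h m else 0.
Proof.
apply: hardy_of_coefE; apply/square_summableP; exists (l2_sqnorm (hcoef h)) => -[|N].
  by rewrite [series _ _]big_geq// l2_sqnorm_ge0//; exact: hcoefP.
rewrite /series /= big_nat_recl//= [0 ^+ 2]expr0n /= addr0 sqrtr0 expr0n add0r.
exact: (l2_sqnorm_ub N (hcoefP h)).
Qed.

Lemma hardy_shiftE h z : `|z| < 1 -> hardy_shift h z = z * h z.
Proof.
move=> z1; apply: cvg_lim => //; rewrite -cvg_shiftS /= hardy_shift_coef.
rewrite (_ : (fun n => _) = fun N => z * series (fun n => hcoef h n * z ^+ n) N).
  by apply: cvgM; [exact: cvg_cst | exact: hardy_val_cvg].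
apply/funext => N; rewrite /series /= big_nat_recl//= mul0r add0r mulr_sumr.
by apply: eq_bigr => n _; rewrite exprS mulrCA.
Qed.

Lemma szegoE l z : `|l| < 1 -> `|z| < 1 -> szego l z = (1 - l^*%C * z)^-1.
Proof.
move=> l1 z1; apply: cvg_lim => //.
have q1 : `|l^*%C * z| < 1.
  by rewrite normrM normcJ mulr_ilt1.
have q0 : 1 - l^*%C * z != 0.
  by rewrite subr_eq0; apply: contraTneq q1 => <-; rewrite normr1 ltxx.
rewrite hardy_of_coefE; last exact: geometric_square_summable (normcJ_lt1 l1).
have -> : (fun n => (l^*%C) ^+ n * z ^+ n) = geometric 1 (l^*%C * z).
  by apply/funext => n; rewrite /= mul1r exprMn.
rewrite geometric_seriesE; last by rewrite -subr_eq0 -opprB oppr_eq0.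
rewrite -[X in _ --> X]mul1r; apply: cvgM; last exact: cvg_cst.
rewrite -[X in _ --> X]subr0; under eq_fun do rewrite mul1r.
apply: cvgB; first exact: cvg_cst.
apply: cvg_series_cvg_0.
have := l2_dot_cvg (geometric_square_summable (normcJ_lt1 l1))
                   (geometric_square_summable (normcJ_lt1 z1)).
by under eq_fun do rewrite rmorphXn /= conjcK -exprMn.
Qed.

End Disc.

Section BlaschkeSpaces.
Context {R : realType}.
Implicit Types (z w : R[i]) (l : nat -> R[i]) (g : R[i] -> R[i]).

Definition normalized_szego w : hardy R :=
  (Num.sqrt (1 - normc w ^+ 2))%:C *: szego w.

Definition blaschke_factor w z : R[i] :=
  `|w| / w * ((w - z) / (1 - w^*%C * z)).

Definition blaschke l z : R[i] := limn (fun N => \prod_(k < N) blaschke_factor (l k) z).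

Definition blaschke_except l n z : R[i] :=
  limn (fun N => \prod_(k < N | k != n :> nat) blaschke_factor (l k) z).

Definition carleson l : Prop :=
  exists2 delta : R, 0 < delta & forall n, delta%:C <= `|blaschke_except l n (l n)|.

Definition BH2 l : set (hardy R) :=
  [set h | exists f : hardy R, forall z, `|z| < 1 -> h z = blaschke l z * f z].

Definition KB l : set (hardy R) := orthocompl (BH2 l).

(* Analyticity on the disc is expressed by a power series expansion at 0. *)
Definition Hinfty g : Prop :=
  (exists c : nat -> R[i], forall z, `|z| < 1 ->
     series (fun n => c n * z ^+ n) @ \oo --> g z) /\
  (exists C : R, forall z, `|z| < 1 -> `|g z| <= C%:C).

Definition expc z : R[i] :=
  (expR (complex.Re z))%:C * (cos (complex.Im z) +i* sin (complex.Im z)).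

Definition herglotz (t : R) z : R[i] :=
  ((cos t +i* sin t) + z) / ((cos t +i* sin t) - z).

(* g z = c exp (1/(2 pi) \int_0^(2 pi) (e^(it) + z)/(e^(it) - z) ln (k t) dt) with
   |c| = 1, k positive and ln k integrable; the integral is taken separately on
   the real and imaginary parts. *)
Definition outer g : Prop :=
  exists (c : R[i]) (k : R -> R),
    [/\ `|c| = 1, (forall t, 0 < k t),
        lebesgue_measure.-integrable `[0, 2 * pi] (fun t => (ln (k t))%:E)
      & forall z, `|z| < 1 -> g z = c * expc (
          ((2 * pi)^-1 * \int[lebesgue_measure]_(t in `[0, 2 * pi])
             (complex.Re (herglotz t z) * ln (k t))) +i*
          ((2 * pi)^-1 * \int[lebesgue_measure]_(t in `[0, 2 * pi])
             (complex.Im (herglotz t z) * ln (k t))))].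

(* The operator matrix ((S, P_(BH^2) S W^* ), (0, R0^* )) on BH^2 (+) H0, where
   W : K_B -> H0. The product type carries the maximum norm, which defines the
   topology of the Hilbert space direct sum. *)
Definition opT (H0 : hilbertType R) l (W : hardy R -> H0) (R0 : H0 -> H0)
    (p : hardy R * H0) : hardy R * H0 :=
  (hardy_shift p.1 + orthoproj (BH2 l) (hardy_shift (adjoint_on (KB l) W p.2)),
   adjoint_on setT R0 p.2).

End BlaschkeSpaces.

Section Families.
Context {R : realType} {H : hilbertType R}.
Implicit Types (x : nat -> H).

Definition finitely_independent x : Prop :=
  forall N (a : nat -> R[i]), \sum_(k < N) a k *: x k = 0 ->
    forall k, (k < N)%N -> a k = 0.

(* The partial sum maps, defined on the finite linear combinations of the x k,
   extend to uniformly bounded operators. *)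
Definition bounded_partial_sums x : Prop :=
  exists P : nat -> H -> H,
    [/\ (forall n, bounded_linear_on setT (P n)),
        (forall n N (a : nat -> R[i]),
           P n (\sum_(k < N) a k *: x k) = \sum_(k < N | (k <= n)%N) a k *: x k)
      & exists C : R, forall n y, `|P n y| <= C%:C * `|y|].

End Families.

(* Main.v *)
Require Import Defs.
From mathcomp Require Import all_boot all_order all_algebra.
From mathcomp Require Import complex.
From mathcomp Require Import all_classical all_reals all_analysis.
From mathcomp Require Import ring lra.

Import Order.TTheory GRing.Theory Num.Theory ComplexField.Normc.
Import numFieldNormedType.Exports.

Local Open Scope classical_set_scope.
Local Open Scope complex_scope.
Local Open Scope ring_scope.

(** Write S for the shift, P for the orthogonal projection onto BH^2, K_B for the
    orthogonal complement of BH^2 and u_n for the normalized Szego kernels.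

    The map Y = I (+) W^* intertwines T with S, that is Y T = S Y, because
    R_0 W = W S^* on the u_n, which are total in K_B.  The subspace M is the range of an
    operator Z = (Z_1, Z_2) going back from H^2, with Z S = T Z.  Then Y Z commutes
    with S, so it is multiplication by a function phi, and Z is recovered from phi:
    Z_1 h is the projection of phi h to BH^2 and Z_2 h is determined by

      <Z_2 h, x_n> = phi(lam_n) <h, u_n>.

    Three things are wanted of phi.

    - Z_2 must exist.  The sequence x_n is a Schauder basis whose coordinate
      functionals are uniformly bounded, hence given by a bounded biorthogonal sequence
      y_n; as the u_n are unit vectors, Z_2 h = sum_n phi(lam_n) <h, u_n> y_n
      converges absolutely as soon as the phi(lam_n) are summable.
    - Z_2 must have dense range, which makes BH^2 and M span everything.  The vectors
      W^* y_m are biorthogonal to the u_n, so Z_2 sends W^* y_m to phi(lam_m) y_m; it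
      is enough that phi(lam_m) is not 0, the y_m being total.
    - Z must be bounded below, so that M is closed and T on M is similar to S.
      Since phi h = Z_1 h + W^* Z_2 h, it is enough that multiplication by phi is
      bounded below.

    All three hold for phi(z) = 1 - z + 3 B(z).  Its values at the zeros lam_n of B are
    1 - lam_n, nonzero and summable by the Carleson condition
    (carleson_summable), and multiplication by 3 B multiplies norms by 3 whereas
    multiplication by 1 - z at most doubles them.

    The function theory behind this is the following.  Multiplication by a
    Blaschke factor is an isometry, as a Cayley transform of the shift, and the partial
    products converge strongly to multiplication by B (isometric_blaschke).  So BH^2
    is closed.  The u_n are total in K_B (KB_vanish): a function vanishing at all
    lam_n can be divided by every partial product, and if it is orthogonal to BH^2
    the quotients tend weakly to 0.  The Hilbert space theory used is the projection
    theorem, the Riesz representation, and adjoints. *)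

Set Implicit Arguments.
Unset Strict Implicit.
Unset Printing Implicit Defensive.

(** * Real-valued norms and absolutely convergent series *)

Section RealNorm.
Context {R : realType}.

(** The norm of a module over R[i] takes its values in R[i], whose order is partial;
    [nrm] is the same number in R. *)
Definition nrm (V : normedModType R[i]) (x : V) : R := complex.Re `|x|.

Lemma nrmE (V : normedModType R[i]) (x : V) : `|x| = (nrm x)%:C.
Proof.
have := normr_ge0 x; rewrite /nrm; case: `|x| => a b.
by rewrite lecE /= => /andP[/eqP -> _].
Qed.

Lemma nrm_ge0 (V : normedModType R[i]) (x : V) : 0 <= nrm x.
Proof. by have := normr_ge0 x; rewrite nrmE lecR. Qed.

Lemma nrmD (V : normedModType R[i]) (x y : V) : nrm (x + y) <= nrm x + nrm y.
Proof. by have := ler_normD x y; rewrite !nrmE -rmorphD /= lecR. Qed.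

Lemma nrmN (V : normedModType R[i]) (x : V) : nrm (- x) = nrm x.
Proof. by rewrite /nrm normrN. Qed.

Lemma nrmB (V : normedModType R[i]) (x y : V) : nrm (x - y) <= nrm x + nrm y.
Proof. by rewrite -[in leRHS](nrmN y) nrmD. Qed.

Lemma nrmBC (V : normedModType R[i]) (x y : V) : nrm (x - y) = nrm (y - x).
Proof. by rewrite /nrm distrC. Qed.

Lemma nrmZ (V : normedModType R[i]) (a : R[i]) (x : V) :
  nrm (a *: x) = normc a * nrm x.
Proof.
have aE : `|a| = (normc a)%:C by case: a.
by have := normrZ a x; rewrite aE !nrmE -rmorphM /= => /complexI.
Qed.

Lemma nrm0 (V : normedModType R[i]) : nrm (0 : V) = 0.
Proof. by rewrite /nrm normr0. Qed.

Lemma nrm_eq0 (V : normedModType R[i]) (x : V) : (nrm x == 0) = (x == 0).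
Proof.
by rewrite -(normr_eq0 x) nrmE -[0 in RHS](rmorph0 (real_complex R)) (inj_eq (@complexI _)).
Qed.

Lemma normc_realE (a : R) : normc a%:C = `|a|.
Proof. by rewrite /= expr0n addr0 sqrtr_sqr. Qed.

Lemma nrm_scalar (a : R[i]) : nrm a = normc a.
Proof. by case: a. Qed.

Lemma nrm_sum (V : normedModType R[i]) (I : Type) (r : seq I) (P : pred I) (F : I -> V) :
  nrm (\sum_(i <- r | P i) F i) <= \sum_(i <- r | P i) nrm (F i).
Proof.
elim/big_rec2: _ => [|i s y _ H]; first by rewrite nrm0.
by apply: le_trans (nrmD _ _) _; rewrite lerD2l.
Qed.

Lemma nrm_le_eps (V : normedModType R[i]) (x : V) :
  (forall e, 0 < e -> nrm x <= e) -> x = 0.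
Proof.
move=> H; apply/eqP; rewrite -nrm_eq0 eq_le nrm_ge0 andbT.
by apply/ler_addgt0Pl => e e0; rewrite addr0 H.
Qed.

Lemma complex_gt0_real (e : R[i]) : 0 < e -> exists2 d : R, e = d%:C & 0 < d.
Proof.
by case: e => x y; rewrite ltcE /= => /andP[/eqP -> x0]; exists x.
Qed.

Lemma cvg_nrmP (V : normedModType R[i]) (u : nat -> V) (l : V) :
  u @ \oo --> l <-> (fun n => nrm (u n - l)) @ \oo --> (0 : R).
Proof.
split => [/cvgrPdist_lt ul|/cvgrPdist_lt ul]; apply/cvgrPdist_lt => e.
  move=> e0; have := ul e%:C; rewrite ltcR => /(_ e0); apply: filterS => n.
  by rewrite sub0r normrN ger0_norm ?nrm_ge0// nrmE ltcR nrmBC.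
move=> /complex_gt0_real[d -> /ul]; apply: filterS => n.
by rewrite sub0r normrN ger0_norm ?nrm_ge0// nrmE ltcR nrmBC.
Qed.

Lemma cvg_nrm_le (V : normedModType R[i]) (u : nat -> V) (l : V) (t : nat -> R) :
  (forall n, nrm (u n - l) <= t n) -> t @ \oo --> (0 : R) -> u @ \oo --> l.
Proof.
move=> H t0; apply/cvg_nrmP; apply: (squeeze_cvgr _ _ t0); last exact: cvg_cst.
by apply: nearW => n; rewrite nrm_ge0 H.
Qed.

Lemma cvg_nrm (V : normedModType R[i]) (u : nat -> V) (l : V) :
  u @ \oo --> l -> (fun n => nrm (u n)) @ \oo --> nrm l.
Proof.
move=> /cvg_nrmP/cvgrPdist_lt ul; apply/cvgrPdist_lt => e /ul; apply: filterS => n.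
rewrite sub0r normrN ger0_norm ?nrm_ge0//; apply: le_lt_trans.
have := nrmB (u n) (u n - l); have := nrmD (u n - l) l.
rewrite subrK subKr ler_norml => ? ?; apply/andP; split; lra.
Qed.

Lemma nrm_cauchy (V : completeNormedModType R[i]) (u : nat -> V) :
  (forall e : R, 0 < e -> exists N, forall n, (N <= n)%N -> nrm (u n - u N) < e) ->
  cvgn u.
Proof.
move=> H; apply: cauchy_cvg; apply/cauchyP => e /complex_gt0_real[d -> /H[N HN]].
exists (u N), N => //= n /= Nn.
by rewrite -ball_normE /ball_ /= nrmE ltcR nrmBC HN.
Qed.

Lemma nrm_series (V : completeNormedModType R[i]) (v : nat -> V) (t : nat -> R) C :
  (forall n, nrm (v n) <= t n) -> (forall n, series t n <= C) ->
  cvgn (series v) /\ nrm (limn (series v)) <= C.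
Proof.
move=> vt tC.
have t0 n : 0 <= t n by apply: le_trans (vt n); exact: nrm_ge0.
have homo : {homo series t : m n / (m <= n)%N >-> m <= n}.
  by apply/nondecreasing_seqP => n; rewrite seriesSr lerDl.
have tcv : cvgn (series t).
  by apply: nondecreasing_is_cvgn => //; exists C => _ [n _ <-].
have dist m n : (m <= n)%N -> nrm (series v n - series v m) <= series t n - series t m.
  move=> mn; rewrite !sub_series_geq//.
  by apply: le_trans (nrm_sum _ _ _) _; apply: ler_sum.
have vcv : cvgn (series v).
  apply: nrm_cauchy => e e0.
  have /cvgrPdist_lt/(_ _ e0)[N _ HN] := tcv.
  exists N => n Nn; apply: le_lt_trans (dist _ _ Nn) _.
  have := HN N (leqnn N) => /=; apply: le_lt_trans; apply: le_trans (ler_norm _).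
  by rewrite lerD2r; apply: nondecreasing_cvgn_le.
split => //; have := cvg_nrm vcv => /cvgr_to_le; apply; apply: nearW => n.
by apply: le_trans (nrm_sum _ _ _) _; apply: le_trans (tC n); apply: ler_sum.
Qed.

Lemma closureP (V : normedModType R[i]) (K : set V) (p : V) :
  closure K p <-> forall e : R, 0 < e -> exists2 x, K x & nrm (p - x) < e.
Proof.
split => [cl e e0|H B].
  have /cl[x [Kx /=]] : nbhs p (ball p e%:C) by apply: nbhsx_ballx; rewrite ltcR.
  by rewrite -ball_normE /ball_ /= nrmE ltcR => ?; exists x.
move=> /nbhs_ballP[e /= /complex_gt0_real[d -> d0]] pB.
have [x Kx px] := H _ d0; exists x; split => //; apply: pB.
by rewrite -ball_normE /ball_ /= nrmE ltcR.
Qed.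

Lemma closedP (V : normedModType R[i]) (K : set V) :
  closed K <-> forall p, (forall e : R, 0 < e -> exists2 x, K x & nrm (p - x) < e) -> K p.
Proof.
by split => H p => [/closureP /H//|/closureP /H].
Qed.

Lemma closed_cvg_seq (V : normedModType R[i]) (K : set V) (u : nat -> V) l :
  closed K -> (forall n, K (u n)) -> u @ \oo --> l -> K l.
Proof.
move=> /closedP cK uK /cvg_nrmP/cvgrPdist_lt ul; apply: cK => e /ul[N _ /(_ N (leqnn N))].
rewrite /= sub0r normrN ger0_norm ?nrm_ge0// => H; exists (u N) => //.
by rewrite nrmBC.
Qed.

End RealNorm.

(** * Subspaces and bounded linear maps *)

Section Subspaces.
Context {R : realType}.

Lemma subspaceD (V : lmodType R[i]) (M : set V) x y :
  subspace_set M -> M x -> M y -> M (x + y).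
Proof. by move=> [_ H] Mx My; have := H 1 _ _ Mx My; rewrite scale1r. Qed.

Lemma subspaceZ (V : lmodType R[i]) (M : set V) a x :
  subspace_set M -> M x -> M (a *: x).
Proof. by move=> [M0 H] Mx; have := H a _ _ Mx M0; rewrite addr0. Qed.

Lemma subspaceB (V : lmodType R[i]) (M : set V) x y :
  subspace_set M -> M x -> M y -> M (x - y).
Proof. by move=> [_ H] Mx My; have := H (-1) _ _ My Mx; rewrite scaleN1r addrC. Qed.

Lemma subspace_setT (V : lmodType R[i]) : subspace_set (setT : set V).
Proof. by []. Qed.

Lemma linear_span_min (V : lmodType R[i]) (X M : set V) :
  subspace_set M -> X `<=` M -> linear_span X `<=` M.
Proof.
move=> sM XM _ [n [a [y [Xy ->]]]]; apply: big_ind => [|? ?|i _]; first by case: sM.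
  exact: subspaceD.
by apply: subspaceZ => //; apply: XM.
Qed.

Lemma linear_spanD (V : lmodType R[i]) (X : set V) x y :
  X x -> X y -> linear_span X (x + y).
Proof.
move=> Xx Xy; exists 2%N, (fun=> 1), (fun i => if i == ord0 then x else y); split.
  by move=> i; case: ifP.
by rewrite big_ord_recl big_ord1 /= !scale1r.
Qed.

Lemma closed_subspace_closure (V : normedModType R[i]) (M : set V) :
  subspace_set M -> subspace_set (closure M).
Proof.
move=> sM; split; first by apply: subset_closure; case: sM.
move=> a x y /closureP cx /closureP cy; apply/closureP => e e0.
have a1 : 0 < normc a + 1 by rewrite ltr_wpDl ?normc_ge0.
have e2 : 0 < e / 2 by rewrite divr_gt0.
have [x' Mx' xx'] := cx _ (divr_gt0 e2 a1).
have [y' My' yy'] := cy _ e2.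
exists (a *: x' + y'); first by case: sM => _; apply.
rewrite opprD addrACA -scalerBr; apply: le_lt_trans (nrmD _ _) _.
rewrite nrmZ [ltRHS](splitr e) ler_ltD//.
rewrite ltr_pdivlMr// in xx'; apply: le_trans (ltW xx').
by rewrite mulrC ler_wpM2l ?nrm_ge0// lerDl.
Qed.

Lemma bounded_linear0 (V W : normedModType R[i]) (D : set V) (f : V -> W) :
  subspace_set D -> bounded_linear_on D f -> f 0 = 0.
Proof.
move=> [D0 _] [fl _]; have := fl 1 _ _ D0 D0.
by rewrite !scale1r addr0 => /eqP; rewrite -subr_eq subrr eq_sym => /eqP.
Qed.

Lemma bounded_linearD (V W : normedModType R[i]) (D : set V) (f : V -> W) x y :
  bounded_linear_on D f -> D x -> D y -> f (x + y) = f x + f y.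
Proof. by move=> [fl _] Dx Dy; have := fl 1 _ _ Dx Dy; rewrite !scale1r. Qed.

Lemma bounded_linearZ (V W : normedModType R[i]) (D : set V) (f : V -> W) a x :
  subspace_set D -> bounded_linear_on D f -> D x -> f (a *: x) = a *: f x.
Proof.
move=> sD fl Dx; have := (fl.1 a _ _ Dx sD.1).
by rewrite (bounded_linear0 sD fl) !addr0.
Qed.

Lemma bounded_linearB (V W : normedModType R[i]) (D : set V) (f : V -> W) x y :
  bounded_linear_on D f -> D x -> D y -> f (x - y) = f x - f y.
Proof.
move=> [fl _] Dx Dy; have := fl (-1) _ _ Dy Dx.
by rewrite !scaleN1r addrC => ->; rewrite addrC.
Qed.

Lemma bounded_linear_bound (V W : normedModType R[i]) (D : set V) (f : V -> W) :
  bounded_linear_on D f -> exists2 C : R, 0 < C & forall x, D x -> nrm (f x) <= C * nrm x.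
Proof.
move=> [_ [C HC]]; exists (`|C| + 1) => [|x /HC]; first by rewrite ltr_wpDl.
rewrite !nrmE -rmorphM /= lecR => /le_trans; apply.
rewrite ler_wpM2r ?nrm_ge0//; have := ler_norm C; lra.
Qed.

Lemma bounded_linearI (V W : normedModType R[i]) (D : set V) (f : V -> W) (C : R) :
  (forall (a : R[i]) x y, D x -> D y -> f (a *: x + y) = a *: f x + f y) ->
  (forall x, D x -> nrm (f x) <= C * nrm x) -> bounded_linear_on D f.
Proof.
by move=> fl fC; split => //; exists C => x /fC; rewrite !nrmE -rmorphM /= lecR.
Qed.

Lemma bounded_linear_cvg (V W : normedModType R[i]) (D : set V) (f : V -> W) (u : nat -> V) l :
  subspace_set D -> bounded_linear_on D f -> (forall n, D (u n)) -> D l ->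
  u @ \oo --> l -> (fun n => f (u n)) @ \oo --> f l.
Proof.
move=> sD fl Du Dl /cvg_nrmP ul; have [C C0 HC] := bounded_linear_bound fl.
apply: (@cvg_nrm_le _ _ _ _ (fun n => C * nrm (u n - l))) => [n|].
  by rewrite -(bounded_linearB fl)//; apply: HC; exact: subspaceB.
by rewrite -[0](mulr0 C); apply: cvgM => //; exact: cvg_cst.
Qed.

(** The range of an operator that is bounded below on a complete space is closed. *)
Lemma closed_range (V : completeNormedModType R[i]) (W : normedModType R[i])
    (f : V -> W) (C : R) :
  bounded_linear_on setT f -> (forall x, nrm x <= C * nrm (f x)) -> closed (range f).
Proof.
move=> fl fC; apply/closedP => p Hp.
have /choice[u Hu] (n : nat) : exists x, nrm (f x - p) < n.+1%:R^-1.
  by have [|_ [x _ <-] px] := Hp n.+1%:R^-1; [rewrite invr_gt0 | exists x; rewrite nrmBC].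
have fu : (fun n => f (u n)) @ \oo --> p.
  apply: (@cvg_nrm_le _ _ _ _ harmonic) => [n|]; last exact: cvg_harmonic.
  exact/ltW/Hu.
have ucv : cvgn u.
  apply: nrm_cauchy => e e0.
  have C1 : 0 < `|C| + 1 by rewrite ltr_wpDl.
  have e2 : 0 < e / 2 / (`|C| + 1) by rewrite !divr_gt0.
  move/cvg_nrmP/cvgrPdist_lt: (fu) => /(_ _ e2)[N _ HN]; exists N => n Nn.
  apply: le_lt_trans (fC _) _; rewrite (bounded_linearB fl)//.
  have Hd k : (N <= k)%N -> nrm (f (u k) - p) * (`|C| + 1) < e / 2.
    by move=> /HN /=; rewrite sub0r normrN ger0_norm ?nrm_ge0// ltr_pdivlMr.
  have := nrmB (f (u n) - p) (f (u N) - p); rewrite opprB addrA subrK.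
  have := Hd n Nn; have := Hd N (leqnn N); have := ler_norm C.
  have := nrm_ge0 (f (u n) - f (u N)); nra.
exists (limn u) => //.
have H := bounded_linear_cvg (@subspace_setT _) fl (fun=> I) I ucv.
exact: (cvg_unique (@norm_hausdorff _ _) H fu).
Qed.

End Subspaces.

(** * Projections, Riesz representation, adjoints *)

Section Hilbert.
Context {R : realType}.
Implicit Types H : hilbertType R.

Lemma hdotDl H (x y z : H) : hdot (x + y) z = hdot x z + hdot y z.
Proof. by have := hdotPl 1 x y z; rewrite scale1r mul1r. Qed.

Lemma hdot0l H (z : H) : hdot 0 z = 0.
Proof.
by apply: (addrI (hdot 0 z)); rewrite -hdotDl !addr0.
Qed.

Lemma hdotZl H a (x z : H) : hdot (a *: x) z = a * hdot x z.
Proof. by have := hdotPl a x 0 z; rewrite !addr0 hdot0l addr0. Qed.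

Lemma hdotNl H (x z : H) : hdot (- x) z = - hdot x z.
Proof. by rewrite -scaleN1r hdotZl mulN1r. Qed.

Lemma hdotBl H (x y z : H) : hdot (x - y) z = hdot x z - hdot y z.
Proof. by rewrite hdotDl hdotNl. Qed.

Lemma hdotDr H (x y z : H) : hdot x (y + z) = hdot x y + hdot x z.
Proof. by rewrite hdotC hdotDl rmorphD /= -!hdotC. Qed.

Lemma hdotZr H a (x y : H) : hdot x (a *: y) = a^*%C * hdot x y.
Proof. by rewrite hdotC hdotZl rmorphM /= -hdotC. Qed.

Lemma hdot0r H (x : H) : hdot x 0 = 0.
Proof. by rewrite hdotC hdot0l rmorph0. Qed.

Lemma hdotNr H (x z : H) : hdot x (- z) = - hdot x z.
Proof. by rewrite hdotC hdotNl rmorphN /= -hdotC. Qed.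

Lemma hdotBr H (x y z : H) : hdot x (y - z) = hdot x y - hdot x z.
Proof. by rewrite hdotDr hdotNr. Qed.

Lemma hdot_eq0C H (x y : H) : hdot x y = 0 -> hdot y x = 0.
Proof. by move=> xy; rewrite hdotC xy rmorph0. Qed.

Lemma hdotxxE H (x : H) : hdot x x = (nrm x ^+ 2)%:C.
Proof. by rewrite hdotxx nrmE rmorphXn. Qed.

Lemma hdotxx_eq0 H (x : H) : hdot x x = 0 -> x = 0.
Proof.
rewrite hdotxxE => /complexI/eqP; rewrite sqrf_eq0 nrm_eq0; exact: eqP.
Qed.

Lemma nrmD_sq H (x y : H) :
  nrm (x + y) ^+ 2 = nrm x ^+ 2 + nrm y ^+ 2 + 2 * complex.Re (hdot x y).
Proof.
apply: (@complexI R); rewrite -hdotxxE !(hdotDl, hdotDr) (hdotC x y) !hdotxxE.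
case: (hdot x y) => a b; apply/eqP; rewrite eq_complex /=; apply/andP; split; apply/eqP; ring.
Qed.

Lemma parallelogram H (x y : H) :
  nrm (x + y) ^+ 2 + nrm (x - y) ^+ 2 = 2 * nrm x ^+ 2 + 2 * nrm y ^+ 2.
Proof.
rewrite !nrmD_sq nrmN hdotNr; case: (hdot x y) => a b /=; ring.
Qed.

(** The coefficient is the one that minimizes the left-hand side, which leaves the part
    of w orthogonal to k; positivity of that part is the Cauchy-Schwarz inequality. *)
Lemma nrmB_proj H (w k : H) : nrm k != 0 ->
  nrm (w - (hdot w k / (nrm k ^+ 2)%:C) *: k) ^+ 2 =
  nrm w ^+ 2 - (normc (hdot w k) / nrm k) ^+ 2.
Proof.
move=> k0; have k0' : (nrm k ^+ 2)%:C != 0 :> R[i].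
  by rewrite (inj_eq (@complexI _) _ 0) expf_neq0.
apply: (@complexI R); apply: etrans (esym (hdotxxE _)) _.
rewrite hdotBl !hdotBr !hdotZl !hdotZr !hdotxxE.
rewrite (hdotC w k); set c := hdot w k; rewrite [in RHS]rmorphB /= expr_div_n.
rewrite [((_ / _))%:C]rmorphM /= [(normc c ^+ 2)%:C](_ : _ = c * c^*%C); last first.
  by rewrite rmorphXn /= sqr_normc.
have -> : (c / (nrm k ^+ 2)%:C)^*%C = c^*%C / (nrm k ^+ 2)%:C.
  rewrite -fmorphV /=; case: (c) => a b; apply/eqP; rewrite eq_complex /=.
  by apply/andP; split; apply/eqP; ring.
rewrite fmorphV /=; field.
by apply: contraNneq k0 => /(@complexI R _ 0) /eqP.
Qed.

Lemma cauchy_schwarz H (x y : H) : normc (hdot x y) <= nrm x * nrm y.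
Proof.
have [y0|y0] := eqVneq (nrm y) 0.
  move/eqP: y0; rewrite nrm_eq0 => /eqP ->.
  by rewrite hdot0r normc0 mulr_ge0 ?nrm_ge0.
have yp : 0 < nrm y by rewrite lt_def y0 nrm_ge0.
rewrite -ler_pdivrMr// -[leLHS]ger0_norm ?divr_ge0 ?normc_ge0 ?nrm_ge0//.
rewrite -[leRHS]ger0_norm ?nrm_ge0// -ler_sqr ?nnegrE ?normr_ge0// !real_normK ?num_real//.
by rewrite -subr_ge0 -(nrmB_proj _ y0) sqr_ge0.
Qed.

Lemma hdot_bounded H (y : H) : bounded_linear_on setT (fun x => hdot x y).
Proof.
apply: (@bounded_linearI _ _ _ _ _ (nrm y)) => [a x z _ _|x _].
  by rewrite hdotPl.
by rewrite nrm_scalar mulrC cauchy_schwarz.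
Qed.

Lemma cvg_hdotl H (u : nat -> H) l y :
  u @ \oo --> l -> (fun n => hdot (u n) y) @ \oo --> hdot l y.
Proof. exact: (bounded_linear_cvg (@subspace_setT _ _) (hdot_bounded y)). Qed.

Lemma closed_hdot0 H (y : H) : closed [set x | hdot x y = 0].
Proof.
apply/closedP => p Hp; apply: nrm_le_eps => e e0.
have y1 : 0 < nrm y + 1 by rewrite ltr_wpDl ?nrm_ge0.
have [x /= xy px] := Hp _ (divr_gt0 e0 y1).
rewrite -[hdot p y]subr0 -xy -hdotBl nrm_scalar.
apply: le_trans (cauchy_schwarz _ _) _; move: px; rewrite ltr_pdivlMr// => px.
apply: le_trans (ltW px); rewrite ler_wpM2l ?nrm_ge0//; lra.
Qed.

Lemma subspace_hdot0 H (y : H) : subspace_set [set x | hdot x y = 0].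
Proof.
split=> [|a u v /= uy vy]; first by rewrite /= hdot0l.
by rewrite hdotPl uy vy mulr0 addr0.
Qed.

Lemma subspace_orthocompl H (K : set H) : subspace_set (orthocompl K).
Proof.
split=> [y _|a u v uK vK y Ky]; first by rewrite hdot0l.
by rewrite hdotPl uK ?vK// mulr0 addr0.
Qed.

Lemma closed_orthocompl H (K : set H) : closed (orthocompl K).
Proof.
apply/closedP => p Hp y Ky.
have /closedP := @closed_hdot0 H y; apply => e /Hp[x xK px].
by exists x => //; exact: xK.
Qed.

Lemma closed_span_min H (X M : set H) :
  subspace_set M -> closed M -> X `<=` M -> closed_span X `<=` M.
Proof.
by move=> sM cM XM x /(closure_subset (linear_span_min sM XM)); exact: cM.
Qed.

Lemma orthogonal_to_total H (X : set H) (y : H) : closed_span X = setT ->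
  (forall v, X v -> hdot v y = 0) -> y = 0.
Proof.
move=> XT Xy; apply: hdotxx_eq0.
have := closed_span_min (subspace_hdot0 y) (@closed_hdot0 _ y) Xy.
by rewrite XT; apply.
Qed.

(** The projection theorem: a minimizing sequence is Cauchy by the
    parallelogram law, and its limit is orthogonal by minimality. *)
Lemma projection_exists H (K : set H) : subspace_set K -> closed K ->
  forall x, exists y, K y /\ orthocompl K (x - y).
Proof.
move=> sK cK x; pose A := [set nrm (x - y) ^+ 2 | y in K].
have lA : lbound A 0 by move=> _ [y _ <-]; exact: sqr_ge0.
have iA : has_inf A.
  by split; [exists (nrm (x - 0) ^+ 2), 0 => //; exact: sK.1 | exists 0].
pose d := inf A.
have dA y : K y -> d <= nrm (x - y) ^+ 2.
  by move=> Ky; apply: ge_inf; [exact: iA.2 | exists y].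
have /choice[u Hu] (n : nat) : exists y, K y /\ nrm (x - y) ^+ 2 < d + n.+1%:R^-1.
  have /inf_adherent/(_ iA)[_ [y Ky <-] ?] : 0 < n.+1%:R^-1 :> R by rewrite invr_gt0.
  by exists y.
have uv n v : K v -> nrm (u n - v) ^+ 2 <= 2 * (n.+1%:R^-1 + nrm (x - v) ^+ 2 - d).
  move=> Kv; have [Ku ud] := Hu n.
  (* The midpoint lies in K, so the parallelogram law bounds the distance of u n and v. *)
  have mid : K (2^-1 *: (u n + v)) by apply: subspaceZ => //; apply: subspaceD.
  have := parallelogram (x - u n) (x - v).
  have -> : x - u n + (x - v) = 2 *: (x - 2^-1 *: (u n + v)).
    by rewrite scalerBr scalerA divff ?pnatr_eq0// scale1r scaler_nat mulr2n opprD addrACA.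
  have -> : x - u n - (x - v) = v - u n by rewrite opprB addrC addrA subrK.
  rewrite nrmZ (_ : normc (2 : R[i]) = 2); last first.
    by rewrite -[2 : R[i]](rmorph_nat (real_complex R)) normc_realE ger0_norm.
  rewrite exprMn (nrmBC v) => E; have := dA _ mid.
  move: E ud; set j := n.+1%:R^-1; set X := nrm (x - v) ^+ 2; set Y := nrm (x - u n) ^+ 2.
  by set Z := nrm (u n - v) ^+ 2; set Q := nrm _ ^+ 2; rewrite -natrX; lra.
have ucv : cvgn u.
  apply: nrm_cauchy => e e0.
  have e4 : 0 < e ^+ 2 / 4 by rewrite divr_gt0 ?exprn_gt0.
  have [N _ HN] := near_infty_natSinv_lt (PosNum e4).
  exists N => n Nn; rewrite -ltr_sqr ?nnegrE ?nrm_ge0 ?(ltW e0)//.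
  have [KN uN] := Hu N; apply: le_lt_trans (uv n _ KN) _.
  have /= := HN N (leqnn N); have /= := HN n Nn; move: uN.
  by set j := N.+1%:R^-1; set i := n.+1%:R^-1; set X := nrm _ ^+ 2; set E := e ^+ 2; lra.
pose y := limn u; have uy : u @ \oo --> y by [].
have Ky : K y by apply: closed_cvg_seq uy => // n; case: (Hu n).
have yd : nrm (x - y) ^+ 2 <= d.
  apply/ler_addgt0Pl => e e0.
  have xu : (fun n => x - u n) @ \oo --> x - y by apply: cvgB => //; exact: cvg_cst.
  have /cvgr_to_le : (fun n => nrm (x - u n) ^+ 2) @ \oo --> nrm (x - y) ^+ 2.
    by rewrite expr2; under eq_fun do rewrite expr2; apply: cvgM; exact: cvg_nrm.
  apply; have [N _ HN] := near_infty_natSinv_lt (PosNum e0).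
  exists N => // n /= Nn; have [_] := Hu n; have /= := HN n Nn.
  by set j := n.+1%:R^-1; set X := nrm _ ^+ 2; lra.
exists y; split => // k Kk.
have [k0|k0] := eqVneq (nrm k) 0.
  by move/eqP: k0; rewrite nrm_eq0 => /eqP ->; rewrite hdot0r.
have := dA (y + (hdot (x - y) k / (nrm k ^+ 2)%:C) *: k).
rewrite opprD addrA nrmB_proj// => /(_ (subspaceD sK Ky (subspaceZ _ sK Kk))) H1.
have : (normc (hdot (x - y) k) / nrm k) ^+ 2 <= 0 by lra.
rewrite real_exprn_even_le0 ?num_real//= mulf_eq0 invr_eq0 (negbTE k0) orbF.
by move=> /eqP; exact: eq0_normc.
Qed.

Lemma orthoprojP H (K : set H) x : subspace_set K -> closed K ->
  K (orthoproj K x) /\ orthocompl K (x - orthoproj K x).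
Proof.
move=> sK cK; rewrite /orthoproj; case: xgetP => [y -> //|no].
by have [y Hy] := projection_exists sK cK x; case: (no y).
Qed.

Lemma orthoproj_eq H (K : set H) x y : subspace_set K -> closed K ->
  K y -> orthocompl K (x - y) -> orthoproj K x = y.
Proof.
move=> sK cK Ky xy; have [Kp xp] := orthoprojP x sK cK.
set p := orthoproj K x in Kp xp *; apply/eqP; rewrite -subr_eq0; apply/eqP/hdotxx_eq0.
have Kpy : K (p - y) by exact: subspaceB.
rewrite [X in hdot X](_ : _ = (x - y) - (x - p)); last by rewrite opprB [RHS]addrC addrA subrK.
by rewrite hdotBl xy ?xp ?subr0.
Qed.

Lemma orthoproj_lin H (K : set H) a x y : subspace_set K -> closed K ->
  orthoproj K (a *: x + y) = a *: orthoproj K x + orthoproj K y.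
Proof.
move=> sK cK; have [Kx xK] := orthoprojP x sK cK; have [Ky yK] := orthoprojP y sK cK.
apply: orthoproj_eq => //; first exact: sK.2.
rewrite opprD addrACA -scalerBr; exact: (subspace_orthocompl K).2.
Qed.

Lemma nrm_orthoproj H (K : set H) x : subspace_set K -> closed K ->
  nrm (orthoproj K x) <= nrm x.
Proof.
move=> sK cK; have [Kx xK] := orthoprojP x sK cK.
rewrite -ler_sqr ?nnegrE ?nrm_ge0// -[in leRHS](subrK (orthoproj K x) x) nrmD_sq.
by rewrite xK//= mulr0 addr0 lerDr sqr_ge0.
Qed.

(** This is how density is proved everywhere below. *)
Lemma closed_subspace_full H (K : set H) : subspace_set K -> closed K ->
  (forall y, orthocompl K y -> y = 0) -> K = setT.
Proof.
move=> sK cK K0; apply/seteqP; split => // x _.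
by have [Kp /K0/eqP] := orthoprojP x sK cK; rewrite subr_eq0 => /eqP ->.
Qed.

(** Riesz: the representing vector is a multiple of the component, orthogonal to
    the kernel, of any vector on which the functional does not vanish. *)
Lemma riesz_representation H (D : set H) (f : H -> R[i]) :
  subspace_set D -> closed D -> bounded_linear_on D f ->
  exists z, D z /\ forall x, D x -> f x = hdot x z.
Proof.
move=> sD cD fl.
have [f0|/existsNP[x0 /not_implyP[Dx0 fx0]]] := pselect (forall x, D x -> f x = 0).
  by exists 0; split=> [|x Dx]; [exact: sD.1 | rewrite f0 ?hdot0r].
pose N := [set x | D x /\ f x = 0].
have sN : subspace_set N.
  split; first by split; [exact: sD.1 | exact: bounded_linear0 sD fl].
  move=> a x y [Dx fx] [Dy fy]; split; first exact: sD.2.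
  by rewrite fl.1// fx fy scaler0 addr0.
have cN : closed N.
  apply/closedP => p Hp; have Dp : D p.
    by move/closedP: cD; apply => e /Hp[x [Dx _] px]; exists x.
  split => //; have [C C0 fC] := bounded_linear_bound fl; apply: nrm_le_eps => e e0.
  have [x [Dx fx] px] := Hp _ (divr_gt0 e0 C0).
  rewrite -[f p]subr0 -fx -(bounded_linearB fl)//; apply: le_trans (fC _ (subspaceB sD Dp Dx)) _.
  by rewrite mulrC -ler_pdivlMr// ltW.
have [[Dp fp] Nw] := orthoprojP x0 sN cN.
set w := x0 - orthoproj N x0 in Nw.
have Dw : D w by exact: subspaceB.
have fw : f w = f x0 by rewrite (bounded_linearB fl)// fp subr0.
have w0 : hdot w w != 0.
  apply/eqP => /hdotxx_eq0 w0; apply: fx0; rewrite -fw w0; exact: bounded_linear0 sD fl.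
exists ((f w / hdot w w)^*%C *: w); split; first exact: subspaceZ.
move=> x Dx; rewrite hdotZr conjcK.
have fw0 : f w != 0 by rewrite fw; exact/eqP.
have : N (x - (f x / f w) *: w).
  split; first by apply: subspaceB => //; exact: subspaceZ.
  rewrite (bounded_linearB fl)//; last exact: subspaceZ.
  by rewrite (bounded_linearZ _ sD fl)// -[_ *: f w]/(_ * f w) divfK ?subrr.
move=> /Nw/hdot_eq0C/eqP; rewrite hdotBl hdotZl subr_eq0 => /eqP ->.
by field; rewrite fw0 w0.
Qed.

Lemma adjoint_onP (H1 H2 : hilbertType R) (D : set H1) (f : H1 -> H2) y :
  subspace_set D -> closed D -> bounded_linear_on D f ->
  D (adjoint_on D f y) /\ forall x, D x -> hdot (f x) y = hdot x (adjoint_on D f y).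
Proof.
move=> sD cD fl; rewrite /adjoint_on; case: xgetP => [z -> //|no].
have [C C0 fC] := bounded_linear_bound fl.
have [|z Hz] := @riesz_representation H1 D (fun x => hdot (f x) y) sD cD.
  apply: (@bounded_linearI _ _ _ _ _ (C * nrm y)) => [a u v Du Dv|u Du].
    by rewrite fl.1// hdotPl.
  rewrite nrm_scalar; apply: le_trans (cauchy_schwarz _ _) _.
  by rewrite mulrAC ler_wpM2r ?nrm_ge0// fC.
by case: (no z).
Qed.

Lemma nrm_adjoint_on (H1 H2 : hilbertType R) (D : set H1) (f : H1 -> H2) :
  subspace_set D -> closed D -> bounded_linear_on D f ->
  exists2 C : R, 0 < C & forall y, nrm (adjoint_on D f y) <= C * nrm y.
Proof.
move=> sD cD fl; have [C C0 fC] := bounded_linear_bound fl; exists C => // y.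
have [Dz Hz] := adjoint_onP y sD cD fl; set z := adjoint_on D f y in Dz Hz *.
have [->|z0] := eqVneq (nrm z) 0; first by rewrite mulr_ge0 ?nrm_ge0 ?ltW.
have zp : 0 < nrm z by rewrite lt_def z0 nrm_ge0.
rewrite -(ler_pM2r zp); have := cauchy_schwarz (f z) y.
rewrite Hz// hdotxxE normc_realE ger0_norm ?sqr_ge0// expr2 => /le_trans; apply.
by rewrite mulrAC ler_wpM2r ?nrm_ge0// fC.
Qed.

End Hilbert.

(** * The Hardy space: evaluation, shifts, identity theorem *)

Section Hardy.
Context {R : realType}.
Implicit Types (h k : hardy R) (z w : R[i]).

Lemma hcoef_ext h k : (forall n, hcoef h n = hcoef k n) -> h = k.
Proof. by move=> hk; apply/val_inj/funext. Qed.

Lemma nrm_hardy_sq h : nrm h ^+ 2 = l2_sqnorm (hcoef h).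
Proof. by rewrite /nrm hardy_normE /= sqr_sqrtr// l2_sqnorm_ge0//; exact: hcoefP. Qed.

Lemma hardy_shift_lin (a : R[i]) h k :
  hardy_shift (a *: h + k) = a *: hardy_shift h + hardy_shift k.
Proof.
apply: hcoef_ext => n; rewrite hcoefD hcoefZ !hardy_shift_coef.
by case: n => [|n]; rewrite ?mulr0 ?addr0.
Qed.

Lemma nrm_hardy_shift h : nrm (hardy_shift h) = nrm h.
Proof.
apply/eqP; rewrite -(@eqrXn2 _ 2)// ?nrm_ge0// !nrm_hardy_sq.
have E N : series (fun n => normc (hcoef (hardy_shift h) n) ^+ 2) N.+1 =
           series (fun n => normc (hcoef h n) ^+ 2) N.
  rewrite /series /= hardy_shift_coef big_nat_recl//= expr0n addr0 sqrtr0 expr0n.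
  exact: add0r.
rewrite eq_le; apply/andP; split; apply: l2_sqnorm_le => N.
  case: N => [|N]; last by rewrite E; apply: l2_sqnorm_ub; exact: hcoefP.
  by rewrite [series _ _]big_geq// l2_sqnorm_ge0//; exact: hcoefP.
by rewrite -E; apply: l2_sqnorm_ub; exact: hcoefP.
Qed.

Lemma hardy_shift_bounded : bounded_linear_on setT (@hardy_shift R).
Proof.
apply: (@bounded_linearI _ _ _ _ _ 1) => [a h k _ _|h _]; first exact: hardy_shift_lin.
by rewrite mul1r nrm_hardy_shift.
Qed.

(** Evaluation is pairing with the Szego kernel; so it is linear and continuous. *)
Lemma hardy_val_dot h z : `|z| < 1 -> h z = hdot h (szego z).
Proof.
move=> z1; rewrite /hardy_val [RHS]/hdot /= /hardy_dot hardy_of_coefE; last first.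
  exact: geometric_square_summable (normcJ_lt1 z1).
by under [in RHS]eq_fun do rewrite rmorphXn /= conjcK.
Qed.

Lemma hardy_val_lin (a : R[i]) h k z : `|z| < 1 -> (a *: h + k : hardy R) z = a * h z + k z.
Proof. by move=> z1; rewrite !hardy_val_dot// hdotPl. Qed.

Lemma hardy_valZ (a : R[i]) h z : `|z| < 1 -> (a *: h : hardy R) z = a * h z.
Proof. by move=> z1; rewrite !hardy_val_dot// hdotZl. Qed.

Lemma hardy_valD h k z : `|z| < 1 -> (h + k : hardy R) z = h z + k z.
Proof. by move=> z1; rewrite !hardy_val_dot// hdotDl. Qed.

Lemma hardy_valN h z : `|z| < 1 -> (- h : hardy R) z = - h z.
Proof. by move=> z1; rewrite !hardy_val_dot// hdotNl. Qed.

Lemma hardy_valB h k z : `|z| < 1 -> (h - k : hardy R) z = h z - k z.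
Proof. by move=> z1; rewrite hardy_valD// hardy_valN. Qed.

Lemma hardy_val_0 z : `|z| < 1 -> (0 : hardy R) z = 0.
Proof. by move=> z1; rewrite hardy_val_dot// hdot0l. Qed.

Lemma cvg_hardy_val (u : nat -> hardy R) h z : `|z| < 1 ->
  u @ \oo --> h -> (fun n => u n z) @ \oo --> h z.
Proof.
move=> z1 uh; rewrite hardy_val_dot//; under eq_fun do rewrite hardy_val_dot//.
exact: cvg_hdotl.
Qed.

Lemma normc_lt1 z : (normc z < 1) = (`|z| < 1).
Proof. by rewrite -nrm_scalar nrmE -[1 in RHS]/(1%:C) ltcR. Qed.

Lemma nrm_szego z : `|z| < 1 -> nrm (szego z) ^+ 2 = (1 - normc z ^+ 2)^-1.
Proof.
move=> z1; apply: (@complexI R); apply: etrans (esym (hdotxxE _)) _.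
rewrite -hardy_val_dot// szegoE// mulrC -[z * _]sqr_normc -rmorphXn /=.
by rewrite fmorphV /= rmorphB.
Qed.

Lemma hardy_val0 h : h 0 = hcoef h 0.
Proof.
apply: cvg_lim => //; apply/cvg_nrmP; apply/cvgrPdist_lt => e e0; exists 1%N => // -[//|n] _.
rewrite /series /= big_nat_recl//= expr0 mulr1 big1 => [|i _]; last first.
  by rewrite expr0n mulr0.
by rewrite addr0 subrr nrm0 subrr normr0.
Qed.

Lemma backward_shift_exists h : exists2 k,
  h = hcoef h 0 *: szego 0 + hardy_shift k & nrm k <= nrm h.
Proof.
have bnd N : series (fun n => normc (hcoef h n.+1) ^+ 2) N <= l2_sqnorm (hcoef h).
  apply: le_trans (l2_sqnorm_ub N.+1 (hcoefP h)).
  by rewrite /series /= big_nat_recl//= lerDr sqr_ge0.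
have s2 : square_summable (fun n => hcoef h n.+1).
  by apply/square_summableP; eexists; exact: bnd.
exists (hardy_of_coef (fun n => hcoef h n.+1)).
  apply: hcoef_ext => n; rewrite hcoefD hcoefZ hardy_shift_coef !hardy_of_coefE//.
    by case: n => [|n]; rewrite ?expr0 ?mulr1 ?addr0// rmorph0 expr0n mulr0 add0r.
  by apply: geometric_square_summable; rewrite rmorph0 normr0 ltr01.
rewrite -ler_sqr ?nnegrE ?nrm_ge0// !nrm_hardy_sq hardy_of_coefE//.
exact: l2_sqnorm_le.
Qed.

Definition backward_shift h : hardy R :=
  xget 0 [set k | h = hcoef h 0 *: szego 0 + hardy_shift k /\ nrm k <= nrm h].

Lemma backward_shiftP h :
  h = hcoef h 0 *: szego 0 + hardy_shift (backward_shift h) /\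
  nrm (backward_shift h) <= nrm h.
Proof.
rewrite /backward_shift; case: xgetP => [k -> //|no].
by have [k H1 H2] := backward_shift_exists h; case: (no k).
Qed.

Lemma szego0_val z : `|z| < 1 -> szego (0 : R[i]) z = 1.
Proof.
move=> z1; rewrite szegoE// ?normr0 ?ltr01//.
by rewrite rmorph0 mul0r subr0 invr1.
Qed.

Lemma backward_shift_val h z : `|z| < 1 -> h z = h 0 + z * backward_shift h z.
Proof.
move=> z1; have [E _] := backward_shiftP h.
by rewrite {1}E hardy_val_lin// szego0_val// mulr1 hardy_shiftE// hardy_val0.
Qed.

Lemma backward_shift_coef h n : hcoef (backward_shift h) n = hcoef h n.+1.
Proof.
have [E _] := backward_shiftP h; rewrite [in RHS]E.
rewrite hcoefD hcoefZ hardy_shift_coef hardy_of_coefE.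
  by rewrite rmorph0 expr0n mulr0 add0r.
by apply: geometric_square_summable; rewrite rmorph0 normr0 ltr01.
Qed.

(** By h(z) = h(0) + z k(z) with k the backward shift of h, the value h(0) is at most
    |z| times a bound for k near 0. *)
Lemma punctured_vanish h :
  (forall z, `|z| < 1 -> z != 0 -> h z = 0) -> hcoef h 0 = 0.
Proof.
move=> h0; apply: nrm_le_eps => e e0.
have N1 : 0 < nrm h + 1 by rewrite ltr_wpDl ?nrm_ge0.
(* At a point t <= 1/2 the Szego kernel has norm at most 2. *)
pose t : R := Num.min 2^-1 (e / (nrm h + 1) / 2).
have t0 : 0 < t by rewrite lt_min invr_gt0 ltr0n/= !divr_gt0.
have t2 : t <= 2^-1 by rewrite ge_min lexx.
have te : t * 2 * nrm h <= e.
  apply: (@le_trans _ _ (e / (nrm h + 1) * (nrm h + 1))); last by rewrite divfK ?gt_eqF.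
  apply: ler_pM; rewrite ?nrm_ge0// ?mulr_ge0 ?(ltW t0)//; last lra.
  by rewrite -ler_pdivlMr// ge_min lexx orbT.
have nt : normc t%:C = t by rewrite normc_realE gtr0_norm.
have z1 : `|t%:C| < 1 :> R[i] by rewrite -normc_lt1 nt; lra.
have := backward_shift_val h z1; rewrite h0//; last first.
  by rewrite (inj_eq (@complexI _) _ 0) gt_eqF.
rewrite hardy_val0 => /esym/eqP; rewrite addr_eq0 => /eqP ->.
rewrite nrm_scalar normcN normcM nt; apply: le_trans te; rewrite -mulrA ler_wpM2l ?(ltW t0)//.
rewrite hardy_val_dot//; apply: le_trans (cauchy_schwarz _ _) _; rewrite mulrC.
apply: ler_pM; rewrite ?nrm_ge0//; last by case: (backward_shiftP h).
rewrite -ler_sqr ?nnegrE ?nrm_ge0// nrm_szego// nt.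
rewrite invf_ple ?posrE ?exprn_gt0//; nra.
Qed.

(** The Taylor coefficients are the values at 0 of the iterated backward shifts, and
    a backward shift of a function vanishing on the disc vanishes off 0.  It
    reduces identities between elements of H^2 to identities between values. *)
Lemma hardy_ext h k : (forall z, `|z| < 1 -> h z = k z) -> h = k.
Proof.
move=> hk; apply/eqP; rewrite -subr_eq0; apply/eqP.
have {hk} : forall z, `|z| < 1 -> z != 0 -> (h - k : hardy R) z = 0.
  by move=> z z1 _; rewrite hardy_valB// hk ?subrr.
move: (h - k : hardy R) => {h k} h hz; apply: hcoef_ext => n; rewrite [RHS]/=.
elim: n h hz => [|n IH] h hz; first exact: punctured_vanish.
rewrite -backward_shift_coef; apply: IH => z z1 z0.
have := backward_shift_val h z1.
rewrite hz// hardy_val0 punctured_vanish// add0r => /esym/eqP.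
by rewrite mulf_eq0 (negbTE z0) => /eqP.
Qed.

End Hardy.

(** * Isometric multipliers and Blaschke factors *)

Section Multipliers.
Context {R : realType}.
Implicit Types (h k : hardy R) (z w : R[i]) (phi psi : R[i] -> R[i]).

Lemma isometry_hdot (H1 H2 : hilbertType R) (f : H1 -> H2) :
  (forall a x y, f (a *: x + y) = a *: f x + f y) ->
  (forall x, nrm (f x) = nrm x) ->
  forall x y, hdot (f x) (f y) = hdot x y.
Proof.
move=> fl fN x y.
have fD u v : f (u + v) = f u + f v by have := fl 1 u v; rewrite !scale1r.
have f0 : f 0 = 0 by apply: (addrI (f 0)); rewrite -fD !addr0.
have fZ a u : f (a *: u) = a *: f u by have := fl a u 0; rewrite f0 !addr0.
have re u v : complex.Re (hdot (f u) (f v)) = complex.Re (hdot u v).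
  have := nrmD_sq (f u) (f v); rewrite -fD !fN nrmD_sq; lra.
have := re ('i%C *: x) y; have := re x y; rewrite fZ !hdotZl.
case: (hdot (f x) _) (hdot x y) => [a b] [c d] /= -> H.
by apply/eqP; rewrite eq_complex /= eqxx; apply/eqP; lra.
Qed.

Lemma neumann (V : completeNormedModType R[i]) (A : V -> V) (r : R) :
  bounded_linear_on setT A -> 0 <= r -> r < 1 -> (forall x, nrm (A x) <= r * nrm x) ->
  forall x : V, exists q, q = x + A q.
Proof.
move=> Al r0 r1 Ar x; pose v n := iter n A x.
have vr n : nrm (v n) <= r ^+ n * nrm x.
  elim: n => [|n IH]; first by rewrite expr0 mul1r.
  by apply: le_trans (Ar _) _; rewrite exprS -mulrA ler_wpM2l.
have sr n : series (fun n => r ^+ n * nrm x) n <= (1 - r)^-1 * nrm x.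
  rewrite /series /= -mulr_suml ler_wpM2r ?nrm_ge0//.
  rewrite -[leRHS]mul1r ler_pdivlMr ?subr_gt0// big_mkord mulrC -opprB mulNr -subrX1 opprB.
  by rewrite lerBlDr lerDl exprn_ge0.
have [vcv _] := nrm_series vr sr.
exists (limn (series v)).
have E n : series v n.+1 = x + A (series v n).
  elim: n => [|n IH].
    by rewrite seriesSr [series v 0]big_geq// (bounded_linear0 (@subspace_setT _ _) Al) add0r addr0.
  by rewrite [LHS]seriesSr [in LHS]IH [in RHS]seriesSr (bounded_linearD Al)// addrA.
have : (fun n => series v n.+1) @ \oo --> limn (series v) by rewrite cvg_shiftS.
rewrite (_ : (fun n => _) = fun n => x + A (series v n)); last exact/funext.
move=> /(cvg_lim (@norm_hausdorff _ _)) L; apply: etrans (esym L) _.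
apply: cvg_lim; first exact: norm_hausdorff.
have H := bounded_linear_cvg (@subspace_setT _ _) Al (fun=> I) I vcv.
by apply: cvgD; [exact: cvg_cst | exact: H].
Qed.

(** Values on the open disc determine an element of H^2, so inner functions are described
    here without boundary values. *)
Definition isometric_multiplier phi := forall h, exists k : hardy R,
  (forall z, `|z| < 1 -> k z = phi z * h z) /\ nrm k = nrm h.

Definition mult phi h : hardy R :=
  xget (0 : hardy R) [set k : hardy R | forall z, `|z| < 1 -> k z = phi z * h z].

Lemma mult_eq phi h k : (forall z, `|z| < 1 -> k z = phi z * h z) -> mult phi h = k.
Proof.
move=> Hk; rewrite /mult; case: xgetP => [k' _ Hk'|no]; last by case: (no k).
by apply: hardy_ext => z z1; rewrite Hk ?Hk'.
Qed.

Lemma mult_val phi h z : isometric_multiplier phi -> `|z| < 1 ->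
  mult phi h z = phi z * h z.
Proof. by move=> im z1; have [k [Hk _]] := im h; rewrite (mult_eq Hk) Hk. Qed.

Lemma nrm_mult phi h : isometric_multiplier phi -> nrm (mult phi h) = nrm h.
Proof. by move=> im; have [k [Hk <-]] := im h; rewrite (mult_eq Hk). Qed.

Lemma mult_lin phi a h k : isometric_multiplier phi ->
  mult phi (a *: h + k) = a *: mult phi h + mult phi k.
Proof.
move=> im; apply: hardy_ext => z z1; rewrite mult_val// !hardy_val_lin// !mult_val//; ring.
Qed.

Lemma multB phi h k : isometric_multiplier phi ->
  mult phi (h - k) = mult phi h - mult phi k.
Proof.
move=> im; apply: hardy_ext => z z1; rewrite mult_val// !hardy_valB// !mult_val//; ring.
Qed.

Lemma mult_shift phi h : isometric_multiplier phi ->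
  mult phi (hardy_shift h) = hardy_shift (mult phi h).
Proof.
move=> im; apply: hardy_ext => z z1; rewrite mult_val// !hardy_shiftE// !mult_val//; ring.
Qed.

Lemma mult_hdot phi h k : isometric_multiplier phi ->
  hdot (mult phi h) (mult phi k) = hdot h k.
Proof.
move=> im; apply: isometry_hdot => [a x y|x]; [exact: mult_lin | exact: nrm_mult].
Qed.

Lemma isometric_multiplier1 : isometric_multiplier (fun=> 1).
Proof. by move=> h; exists h; split => // z _; rewrite mul1r. Qed.

Lemma isometric_multiplierM phi psi : isometric_multiplier phi ->
  isometric_multiplier psi -> isometric_multiplier (fun z => phi z * psi z).
Proof.
move=> iphi ipsi h; have [k [Hk <-]] := ipsi h; have [k' [Hk' <-]] := iphi k.
by exists k'; split => // z z1; rewrite Hk'// Hk// mulrA.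
Qed.

Lemma one_sub_mul_neq0 (r : R) z : 0 < r < 1 -> `|z| < 1 -> 1 - r%:C * z != 0.
Proof.
move=> /andP[r0 r1] z1; rewrite subr_eq0; apply/eqP => /(congr1 (@normc R)).
rewrite normcM normc_realE normc1 gtr0_norm// => E.
have : normc z < 1 by rewrite normc_lt1.
have := normc_ge0 z; nra.
Qed.

Lemma blaschke_factor_real (r : R) z : 0 < r ->
  blaschke_factor r%:C z = (r%:C - z) / (1 - r%:C * z).
Proof.
move=> r0; rewrite /blaschke_factor.
have -> : `|r%:C| = r%:C :> R[i] by rewrite ger0_norm// lecR ltW.
rewrite divff ?mul1r ?(inj_eq (@complexI _) _ 0) ?gt_eqF//.
by rewrite -[(r%:C)^*%C]/(conjc r%:C) (_ : conjc r%:C = r%:C)//= oppr0.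
Qed.

(** Multiplication by a Blaschke factor is (r - S)(1 - r S)^-1, and r - S and 1 - r S
    change norms by the same amount because S is an isometry. *)
Lemma isometric_blaschke_factor (r : R) : 0 < r < 1 ->
  isometric_multiplier (blaschke_factor r%:C).
Proof.
move=> r01 h; have /andP[r0 r1] := r01.
have [||||q Hq] := @neumann (hardy R) (fun x => r%:C *: hardy_shift x) r _ _ _ _ h.
- apply: (@bounded_linearI _ _ _ _ _ r) => [a x y _ _|x _].
    by rewrite hardy_shift_lin scalerDr !scalerA (mulrC a).
  by rewrite nrmZ nrm_hardy_shift normc_realE gtr0_norm.
- exact: ltW.
- by [].
- by move=> x; rewrite nrmZ nrm_hardy_shift normc_realE gtr0_norm.
have hE : h = q - r%:C *: hardy_shift q by apply/eqP; rewrite eq_sym subr_eq; exact/eqP.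
exists (r%:C *: q - hardy_shift q); split=> [z z1|].
  rewrite blaschke_factor_real// hE !hardy_valB// !hardy_valZ// !hardy_shiftE//.
  by field; exact: one_sub_mul_neq0.
apply/eqP; rewrite -(@eqrXn2 _ 2)// ?nrm_ge0// hE !nrmD_sq !nrmN !hdotNr !nrmZ.
rewrite hdotZl hdotZr nrm_hardy_shift normc_realE gtr0_norm// [(r%:C^*)%C](_ : _ = r%:C).
  by apply/eqP; case: (hdot _ _) => a b /=; ring.
by rewrite -[_^*%C]/(conjc r%:C) /= oppr0.
Qed.

(** Division by a Blaschke factor: the difference quotient of f at r is
    (1 - r L)^-1 L f with L the backward shift. *)
Lemma divide_blaschke_factor (r : R) (f : hardy R) : 0 < r < 1 -> f r%:C = 0 ->
  exists k : hardy R, forall z, `|z| < 1 -> f z = blaschke_factor r%:C z * k z.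
Proof.
move=> r01 fr; have /andP[r0 r1] := r01.
have Lr x : nrm (r%:C *: backward_shift x) <= r * nrm x.
  by rewrite nrmZ normc_realE gtr0_norm// ler_wpM2l ?(ltW r0)//; case: (backward_shiftP x).
have [|||p Hp] := @neumann (hardy R) (fun x => r%:C *: backward_shift x) r _ _ _ Lr
  (backward_shift f).
- apply: (@bounded_linearI _ _ _ _ _ r) => [a x y _ _|//].
  apply: hcoef_ext => n; rewrite !(hcoefD, hcoefZ) !backward_shift_coef hcoefD hcoefZ; ring.
- exact: ltW.
- by [].
have rz1 : `|r%:C| < 1 :> R[i] by rewrite -normc_lt1 normc_realE gtr0_norm.
have pE z : `|z| < 1 -> (z - r%:C) * p z = f z - (f 0 + r%:C * p 0).
  move=> z1; have := backward_shift_val f z1; have := backward_shift_val p z1.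
  have -> : p z = backward_shift f z + r%:C * backward_shift p z.
    by rewrite {1}Hp hardy_valD// hardy_valZ.
  move: (f z) (f 0) (p 0) (backward_shift f z) (backward_shift p z).
  move=> fz f0 p0 Lf Lp E1 ->.
  have -> : p0 = Lf + r%:C * Lp - z * Lp by rewrite E1 addrK.
  ring.
have p0 : f 0 + r%:C * p 0 = 0.
  by have := pE _ rz1; rewrite subrr mul0r fr sub0r => /esym/eqP; rewrite oppr_eq0 => /eqP.
exists (r%:C *: hardy_shift p - p) => z z1.
rewrite blaschke_factor_real// hardy_valB// hardy_valZ// hardy_shiftE//.
have := pE z z1; rewrite p0 subr0 => <-; field; exact: one_sub_mul_neq0.
Qed.

Lemma cvg_hdotr (H : hilbertType R) (u : nat -> H) l y :
  u @ \oo --> l -> (fun n => hdot y (u n)) @ \oo --> hdot y l.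
Proof.
move=> /cvg_nrmP ul.
apply: (@cvg_nrm_le _ _ _ _ (fun n => nrm y * nrm (u n - l))) => [n|].
  by rewrite -hdotBr nrm_scalar cauchy_schwarz.
by rewrite -[0](mulr0 (nrm y)); apply: cvgM => //; exact: cvg_cst.
Qed.

End Multipliers.

(** * The Blaschke product and its model space *)

Section BlaschkeMultiples.
Context {R : realType}.

Lemma subspace_BH2 (l : nat -> R[i]) : subspace_set (BH2 l).
Proof.
split; first by exists 0 => z z1; rewrite hardy_val_0// mulr0.
move=> a x y [h Hh] [k Hk]; exists (a *: h + k) => z z1.
rewrite !hardy_val_lin// Hh// Hk//; ring.
Qed.

Lemma BH2_shift (l : nat -> R[i]) (h : hardy R) :
  BH2 l h -> BH2 l (hardy_shift h).
Proof.
move=> [f Hf]; exists (hardy_shift f) => z z1.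
by rewrite !hardy_shiftE// Hf// mulrCA.
Qed.

End BlaschkeMultiples.

Section Blaschke.
Context {R : realType}.
Variable lam : nat -> R.
Hypothesis lam01 : forall n, 0 < lam n < 1.
Let l n : R[i] := (lam n)%:C.

Definition blaschke_range m n z : R[i] := \prod_(m <= k < n) blaschke_factor (l k) z.

Lemma isometric_blaschke_range m n : isometric_multiplier (blaschke_range m n).
Proof.
elim: n => [|n IH].
  rewrite (_ : blaschke_range m 0 = fun=> 1); first exact: isometric_multiplier1.
  by apply/funext => z; rewrite /blaschke_range big_geq.
have [mn|nm] := leqP m n; last first.
  rewrite (_ : blaschke_range m n.+1 = fun=> 1); first exact: isometric_multiplier1.
  by apply/funext => z; rewrite /blaschke_range big_geq.
rewrite (_ : blaschke_range m n.+1 = fun z => blaschke_range m n z * blaschke_factor (l n) z).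
  by apply: isometric_multiplierM => //; exact: isometric_blaschke_factor.
by apply/funext => z; rewrite /blaschke_range big_nat_recr.
Qed.

Lemma blaschke_range_val0 m n : blaschke_range m n 0 = (\prod_(m <= k < n) lam k)%:C.
Proof.
rewrite /blaschke_range rmorph_prod /=; apply: eq_bigr => k _.
rewrite blaschke_factor_real; last by case/andP: (lam01 k).
by rewrite mulr0 !subr0 divr1.
Qed.

Lemma prod_ge_1Bsum m n :
  1 - \sum_(m <= k < n) (1 - lam k) <= \prod_(m <= k < n) lam k <= 1.
Proof.
elim: n => [|n IH]; first by rewrite !big_geq// subr0 !lexx.
have [mn|nm] := leqP m n; last by rewrite !big_geq// subr0 !lexx.
rewrite !big_nat_recr//=; move: IH; set s := \sum_(_ <= _ < _) _.
set p := \prod_(_ <= _ < _) _ => /andP[sp p1].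
have /andP[l0 l1] := lam01 n.
have s0 : 0 <= s.
  by apply: sumr_ge0 => i _; have /andP[_] := lam01 i; rewrite subr_ge0 => /ltW.
have p0 : 0 <= p by apply: prodr_ge0 => i _; have /andP[/ltW] := lam01 i.
apply/andP; split; nra.
Qed.

Let is_cvg_lin (V : normedModType R[i]) a (u v : nat -> V) :
  cvgn u -> cvgn v -> cvgn (fun n => a *: u n + v n).
Proof.
move=> ucv vcv; apply/cvg_ex; exists (a *: limn u + limn v).
by apply: cvgD => //; exact: cvgZl_tmp.
Qed.

Let nrm_triangle4 (V : normedModType R[i]) (x x' y y' c : V) (e : R) :
  nrm (x - x') < e / 4 -> nrm (x' - c) < e / 4 ->
  nrm (y - y') < e / 4 -> nrm (y' - c) < e / 4 -> nrm (x - y) < e.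
Proof.
have := nrmB (x - c) (y - c); rewrite opprB addrA subrK.
have := nrmD (x - x') (x' - c); have := nrmD (y - y') (y' - c).
rewrite !addrA !subrK; lra.
Qed.

Hypothesis lam_sum : exists C, forall n, series (fun k => 1 - lam k) n <= C.

Let b N h : hardy R := mult (blaschke_range 0 N) h.
Let im N : isometric_multiplier (blaschke_range 0 N) := isometric_blaschke_range 0 N.

Let szego0_norm : nrm (szego (0 : R[i])) = 1.
Proof.
have z1 : `|0 : R[i]| < 1 by rewrite normr0 ltr01.
apply/eqP; rewrite -(@eqrXn2 _ 2)// ?nrm_ge0// nrm_szego//.
by rewrite normc0 expr0n subr0 invr1 expr1n.
Qed.

(** For the product q of the factors from m to n, the isometry property turns the
    distance of the two partial products into |q - 1|, and |q - 1|^2 = 2 - 2 q(0) with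
    q(0) the product of the lam k. *)
Let b_cauchy_1 m n : (m <= n)%N -> nrm (b n (szego 0) - b m (szego 0)) ^+ 2 <=
  2 * (series (fun k => 1 - lam k) n - series (fun k => 1 - lam k) m).
Proof.
move=> mn; have z1 : `|0 : R[i]| < 1 by rewrite normr0 ltr01.
have it := isometric_blaschke_range m n.
have -> : b n (szego 0) = b m (mult (blaschke_range m n) (szego 0)).
  apply: hardy_ext => z z1'; rewrite !mult_val// mulrA; congr (_ * _).
  by rewrite /blaschke_range -big_cat_nat.
rewrite -multB// nrm_mult// nrmD_sq nrmN hdotNr nrm_mult// szego0_norm.
rewrite -hardy_val_dot// mult_val// szego0_val// mulr1 blaschke_range_val0/=.
rewrite sub_series_geq//; have /andP[] := prod_ge_1Bsum m n; lra.
Qed.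

Let b_cvg_1 : cvgn (fun N => b N (szego 0)).
Proof.
have [C HC] := lam_sum.
have homo : {homo series (fun k => 1 - lam k) : m n / (m <= n)%N >-> m <= n}.
  by apply/nondecreasing_seqP => n; rewrite seriesSr lerDl subr_ge0; case/andP: (lam01 n) => _ /ltW.
have scv : cvgn (series (fun k => 1 - lam k)).
  by apply: nondecreasing_is_cvgn => //; exists C => _ [n _ <-].
apply: nrm_cauchy => e e0.
have e2 : 0 < e ^+ 2 / 2 by rewrite divr_gt0 ?exprn_gt0.
have /cvgrPdist_lt/(_ _ e2)[N _ HN] := scv.
exists N => n Nn; rewrite -ltr_sqr ?nnegrE ?nrm_ge0 ?(ltW e0)//.
apply: le_lt_trans (b_cauchy_1 Nn) _.
have := HN N (leqnn N) => /=; have := nondecreasing_cvgn_le homo scv n.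
have := nondecreasing_cvgn_le homo scv N => ? ?.
by rewrite ger0_norm ?subr_ge0//; lra.
Qed.

(** The set of h on which the partial products converge is a closed subspace
    (isometries), invariant under the shift, and it contains 1; so it contains all
    monomials, and nothing is orthogonal to it. *)
Let b_cvg h : cvgn (fun N => b N h).
Proof.
pose D := [set h : hardy R | cvgn (fun N => b N h)].
suff DT : D = setT by have : D h by rewrite DT.
have sD : subspace_set D.
  split=> [|a x y Dx Dy]; rewrite /D /=.
    rewrite (_ : (fun N => _) = fun=> 0); first exact: is_cvg_cst.
    by apply/funext => N; apply: mult_eq => z z1; rewrite hardy_val_0// mulr0.
  rewrite (_ : (fun N => _) = fun N => a *: b N x + b N y); last first.
    by apply/funext => N; rewrite /b mult_lin.
  exact: (@is_cvg_lin (hardy R) a _ _ Dx Dy).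
have cD : closed D.
  apply/closedP => p Hp; apply: nrm_cauchy => e e0.
  have e4 : 0 < e / 4 by rewrite divr_gt0.
  have [x Dx px] := Hp _ e4.
  have /cvg_nrmP/cvgrPdist_lt/(_ _ e4)[N _ HN] := Dx.
  exists N => n Nn.
  have Hx k : (N <= k)%N -> nrm (b k x - limn (fun N => b N x)) < e / 4.
    by move=> /HN /=; rewrite sub0r normrN ger0_norm ?nrm_ge0.
  have Hb k : nrm (b k p - b k x) < e / 4 by rewrite /b -multB// nrm_mult.
  exact: (nrm_triangle4 (Hb n) (Hx n Nn) (Hb N) (Hx N (leqnn N))).
apply: closed_subspace_full => // y yD.
have yS g : D g -> D (hardy_shift g).
  rewrite /D /= => /cvg_ex[k hk]; apply/cvg_ex; exists (hardy_shift k).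
  rewrite (_ : (fun N => _) = fun N => hardy_shift (b N g)); last first.
    by apply/funext => N; exact: mult_shift.
  exact: (bounded_linear_cvg (@subspace_setT _ _) (@hardy_shift_bounded R) (fun=> I) I hk).
have e0 n : hcoef (iter n (@hardy_shift R) (szego 0)) = fun k => (k == n)%:R.
  elim: n => [|n IH].
    rewrite hardy_of_coefE ?rmorph0.
      by apply/funext => -[|k]; rewrite ?expr0 ?expr0n.
    by apply: geometric_square_summable; rewrite normr0 ltr01.
  rewrite iterS hardy_shift_coef IH; apply/funext => -[|k] /=; first by rewrite mulr0n.
  by rewrite eqSS.
have De n : D (iter n (@hardy_shift R) (szego 0)) by elim: n => [|n]; [exact: b_cvg_1 | exact: yS].
apply: hcoef_ext => n; rewrite [RHS]/=.
have := yD _ (De n); rewrite [hdot _ _](_ : _ = hcoef y n)//.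
rewrite /hdot /= /hardy_dot e0; apply: cvg_lim; first exact: norm_hausdorff.
apply/cvg_nrmP; apply/cvgrPdist_lt => e e1; exists n.+1 => // N /= nN.
rewrite /series /= (bigD1_seq n) ?mem_iota ?iota_uniq ?subn0//= ?mem_index_iota ?index_iota_uniq//.
rewrite big1 => [|i /negbTE ->]; last by rewrite rmorph0 mulr0.
by rewrite eqxx rmorph1 mulr1 addr0 subrr nrm0 subrr normr0.
Qed.

Lemma blaschke_cvg z : `|z| < 1 -> (fun N => blaschke_range 0 N z) @ \oo --> blaschke l z.
Proof.
move=> z1; have := cvg_hardy_val z1 (@b_cvg (szego 0)).
rewrite (_ : (fun N => _) = fun N => blaschke_range 0 N z); last first.
  by apply/funext => N; rewrite /b mult_val// szego0_val// mulr1.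
have -> : blaschke l z = limn (fun N => blaschke_range 0 N z).
  by rewrite /blaschke /blaschke_range; under [in RHS]eq_fun do rewrite big_mkord.
by move=> H; apply/cvg_ex; eexists; exact: H.
Qed.

Let b_lim_val h z : `|z| < 1 -> (limn (fun N => b N h) : hardy R) z = blaschke l z * h z.
Proof.
move=> z1; have := cvg_hardy_val z1 (@b_cvg h).
rewrite (_ : (fun N => _) = fun N => blaschke_range 0 N z * h z); last first.
  by apply/funext => N; rewrite /b mult_val.
move=> H; apply: (cvg_unique (@norm_hausdorff _ _) H).
by apply: cvgM; [exact: blaschke_cvg | exact: cvg_cst].
Qed.

Lemma isometric_blaschke : isometric_multiplier (blaschke l).
Proof.
move=> h; exists (limn (fun N => b N h)); split=> [z z1|]; first exact: b_lim_val.
have := cvg_nrm (@b_cvg h).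
rewrite (_ : (fun N => _) = fun=> nrm h); last first.
  by apply/funext => N; rewrite /b nrm_mult.
move=> H; apply: (cvg_unique (@norm_hausdorff _ _) H); exact: cvg_cst.
Qed.

Lemma mult_blaschke_cvg h :
  (fun N => mult (blaschke_range 0 N) h) @ \oo --> mult (blaschke l) h.
Proof.
by rewrite (_ : mult (blaschke l) h = limn (fun N => b N h));
  [exact: b_cvg | apply: mult_eq => z z1; exact: b_lim_val].
Qed.

Let l_lt1 n : `|l n| < 1.
Proof. by rewrite -normc_lt1 normc_realE gtr0_norm; case/andP: (lam01 n). Qed.

Lemma blaschke_factor_zero (r : R) : 0 < r -> blaschke_factor r%:C r%:C = 0.
Proof. by move=> r0; rewrite blaschke_factor_real// subrr mul0r. Qed.

Lemma blaschke_zero n : blaschke l (l n) = 0.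
Proof.
apply: (cvg_unique (@norm_hausdorff _ _) (blaschke_cvg (l_lt1 n))).
apply/cvg_nrmP; apply/cvgrPdist_lt => e e1; exists n.+1 => // N /= nN.
rewrite /blaschke_range (bigD1_seq n) ?mem_index_iota ?iota_uniq//=.
rewrite blaschke_factor_zero; last by case/andP: (lam01 n).
by rewrite mul0r subrr nrm0 subrr normr0.
Qed.

Lemma BH2_mult h : BH2 l (mult (blaschke l) h).
Proof. by exists h => z z1; rewrite mult_val//; exact: isometric_blaschke. Qed.

Lemma closed_BH2 : closed (BH2 l).
Proof.
rewrite (_ : BH2 l = range (mult (blaschke l))); last first.
  apply/seteqP; split=> [h [f Hf]|_ [h _ <-]]; last exact: BH2_mult.
  by exists f => //; apply: mult_eq.
apply: (@closed_range _ _ _ _ 1) => [|h].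
  apply: (@bounded_linearI _ _ _ _ _ 1) => [a x y _ _|x _].
    by rewrite mult_lin//; exact: isometric_blaschke.
  by rewrite mul1r nrm_mult//; exact: isometric_blaschke.
by rewrite mul1r nrm_mult//; exact: isometric_blaschke.
Qed.

Hypothesis lam_inj : injective lam.

Let divide_all (f : hardy R) N : (forall n, f (l n) = 0) ->
  exists k : hardy R, forall z, `|z| < 1 -> f z = blaschke_range 0 N z * k z.
Proof.
move=> f0; elim: N => [|N [k Hk]].
  by exists f => z _; rewrite /blaschke_range big_geq// mul1r.
have BN0 : blaschke_range 0 N (l N) != 0.
  rewrite /blaschke_range big_mkord; apply/prodf_neq0 => i _.
  rewrite blaschke_factor_real; last by case/andP: (lam01 i).
  rewrite mulf_neq0 ?invr_eq0 ?(one_sub_mul_neq0 (lam01 i) (l_lt1 N))// subr_eq0.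
  apply/eqP => /complexI/lam_inj iE; have := ltn_ord i.
  by rewrite iE ltnn.
have kN : k (l N) = 0.
  by have /eqP := Hk _ (l_lt1 N); rewrite f0 eq_sym mulf_eq0 (negbTE BN0) => /eqP.
have [k' Hk'] := divide_blaschke_factor (lam01 N) kN.
by exists k' => z z1; rewrite Hk// Hk'// mulrA /blaschke_range big_nat_recr.
Qed.

(** Totality of the kernels u_n in K_B.  After division of f by the N-th partial product
    b_N, the inner product of the quotient with w is that of f with b_N w, since b_N is
    isometric.  It tends to the inner product of f with B w, which is 0.  So the
    quotients f / b_N tend weakly to 0, in particular pointwise; as b_N converges pointwise,
    f = b_N (f / b_N) tends to 0, that is, f = 0. *)
Lemma KB_vanish f : KB l f -> (forall n, f (l n) = 0) -> f = 0.
Proof.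
move=> fK f0; have /choice[k Hk] N := @divide_all f N f0.
have fE N : f = b N (k N) by rewrite /b (mult_eq (Hk N)).
have kw (w : hardy R) : (fun N => hdot (k N) w) @ \oo --> 0.
  have := @cvg_hdotr _ _ _ _ f (@mult_blaschke_cvg w); rewrite (fK _ (BH2_mult w)).
  by under eq_fun => N do rewrite {1}(fE N) /b mult_hdot//.
apply: hardy_ext => z z1; rewrite hardy_val_0//.
have : (fun N => blaschke_range 0 N z * k N z) @ \oo --> blaschke l z * 0.
  apply: cvgM; first exact: blaschke_cvg.
  by under eq_fun do rewrite hardy_val_dot//; exact: kw.
under eq_fun do rewrite -Hk//.
by rewrite mulr0 => H; apply: (cvg_unique (@norm_hausdorff _ _) _ H); exact: cvg_cst.
Qed.

End Blaschke.

(** * Intertwining operators into a direct sum *)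

Section Products.
Context {R : realType}.

Lemma nrm_pair (V W : normedModType R[i]) (p : V * W) :
  [/\ nrm p.1 <= nrm p, nrm p.2 <= nrm p & nrm p <= nrm p.1 + nrm p.2].
Proof.
have -> : nrm p = Num.max (nrm p.1) (nrm p.2).
  apply: (@complexI R); rewrite -nrmE prod_normE !nrmE !maxEle lecR.
  by case: ifP.
have := nrm_ge0 p.1; have := nrm_ge0 p.2.
rewrite ge_max !le_max !lexx orbT; split => //; apply/andP; split; lra.
Qed.

(** If Z = (Z1, Z2) intertwines S with T and is bounded below, its range is closed
    and T acts there as S; modulo B (+) 0 it is dense as soon as Z2 has dense range. *)
Lemma intertwiner_range (E H : hilbertType R) (B : set E) (S : E -> E)
    (T : E * H -> E * H) (Z1 : E -> E) (Z2 : E -> H) (C : R) :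
  subspace_set B -> closed B ->
  bounded_linear_on setT Z1 -> bounded_linear_on setT Z2 ->
  (forall h, B (Z1 h)) ->
  (forall h, nrm h <= C * nrm (Z1 h, Z2 h)) ->
  (forall h, T (Z1 h, Z2 h) = (Z1 (S h), Z2 (S h))) ->
  closure (range Z2) = setT ->
  exists M : set (E * H),
    [/\ subspace_set M /\ closed M, M `<=` B `*` setT, (forall p, M p -> M (T p)),
        similar_on M T setT S
      & closed_span ((B `*` [set 0]) `|` M) = B `*` setT].
Proof.
move=> sB cB Z1l Z2l Z1B ZC TZ Z2d; pose Z h := (Z1 h, Z2 h).
have Zl : bounded_linear_on setT Z.
  have [C1 _ HC1] := bounded_linear_bound Z1l; have [C2 _ HC2] := bounded_linear_bound Z2l.
  apply: (@bounded_linearI _ _ _ _ _ (C1 + C2)) => [a h k _ _|h _].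
    by rewrite /Z Z1l.1// Z2l.1.
  have [_ _] := nrm_pair (Z h); move=> /le_trans; apply.
  by rewrite mulrDl lerD ?HC1 ?HC2.
have Zinj : injective Z.
  move=> h k hk; apply/eqP; rewrite -subr_eq0 -nrm_eq0; apply/eqP/le_anti.
  rewrite nrm_ge0 andbT; apply: le_trans (ZC _) _.
  by rewrite -/(Z _) (bounded_linearB Zl)// hk subrr nrm0 mulr0.
have sM : subspace_set (range Z).
  split; first by exists 0 => //; rewrite (bounded_linear0 (@subspace_setT _ _) Zl).
  by move=> a _ _ [h _ <-] [k _ <-]; exists (a *: h + k) => //; rewrite Zl.1.
have cM : closed (range Z) by exact: closed_range Zl ZC.
have MB : range Z `<=` B `*` setT by move=> _ [h _ <-]; split => //=.
exists (range Z); split => //.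
- by move=> _ [h _ <-]; exists (S h) => //; rewrite [in RHS]/Z TZ.
- pose X p := xget (0 : E) [set h | Z h = p].
  have XZ h : X (Z h) = h.
    by rewrite /X; case: xgetP => [k _ /Zinj//|no]; case: (no h).
  exists X, Z; split => //.
  + split => //; apply: (@bounded_linearI _ _ _ _ _ C) => [a _ _ [h _ <-] [k _ <-]|_ [h _ <-]].
      by rewrite -Zl.1// !XZ.
    by rewrite XZ.
  + by move=> _ [h _ <-]; rewrite XZ.
  + by move=> _ [h _ <-]; rewrite [in LHS]/Z TZ !XZ.
have sBT : subspace_set (B `*` (setT : set H)).
  split; first by split => //=; exact: sB.1.
  by move=> a p q [Bp _] [Bq _]; split => //=; exact: sB.2.
apply/seteqP; split => [p|[b y] [/= Bb _]].
  have cBT : closed (B `*` (setT : set H)).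
    apply/closedP => q Hq; split => //=; move/closedP: cB; apply => e /Hq[r [Br _] qr].
    by exists r.1 => //; apply: le_lt_trans qr; have [] := nrm_pair (q - r).
  move=> cp; apply: cBT; apply: closure_subset cp; apply: linear_span_min => //.
  by move=> q [[Bq _]|/MB//]; split.
apply/closureP => e e0.
have /closureP/(_ _ e0)[_ [h _ <-] yh] : closure (range Z2) y by rewrite Z2d.
exists ((b - Z1 h, 0) + Z h).
  apply: linear_spanD; first by left; split => //=; exact: subspaceB.
  by right; exists h.
apply: le_lt_trans yh; have [_ _] := nrm_pair ((b, y) - ((b - Z1 h, 0) + Z h)).
by rewrite /= subrK add0r subrr nrm0 add0r.
Qed.

Lemma eq_on_closed_span (H : hilbertType R) (W : normedModType R[i]) (X : set H) (f g : H -> W) :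
  closed_span X = setT -> bounded_linear_on setT f -> bounded_linear_on setT g ->
  (forall v, X v -> f v = g v) -> forall v, f v = g v.
Proof.
move=> XT fl gl fg v; pose K := [set v | f v = g v].
have sK : subspace_set K.
  split.
    by rewrite /K/= (bounded_linear0 (@subspace_setT _ _) fl) (bounded_linear0 (@subspace_setT _ _) gl).
  by move=> a p q pK qK; rewrite /K/= fl.1// gl.1// pK qK.
have cK : closed K.
  apply/closedP => p Hp; apply/eqP; rewrite -subr_eq0; apply/eqP/nrm_le_eps => e e0.
  have [C C0 fC] := bounded_linear_bound fl; have [D D0 gD] := bounded_linear_bound gl.
  have [q qK pq] := Hp _ (divr_gt0 e0 (addr_gt0 C0 D0)).
  have -> : f p - g p = f (p - q) - g (p - q).
    by rewrite (bounded_linearB fl)// (bounded_linearB gl)// qK opprB addrA subrK.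
  apply: le_trans (nrmB _ _) _; move: pq; rewrite ltr_pdivlMr ?addr_gt0// => /ltW.
  apply: le_trans; have := fC (p - q) I; have := gD (p - q) I; lra.
by have := closed_span_min sK cK fg; rewrite XT; apply.
Qed.

Lemma bounded_linear_sum (H W : normedModType R[i]) (f : nat -> H -> W) N :
  (forall n, bounded_linear_on setT (f n)) ->
  bounded_linear_on setT (fun x => \sum_(k < N) f k x).
Proof.
move=> fl; elim: N => [|N IH].
  apply: (@bounded_linearI _ _ _ _ _ 0) => [a x y _ _|x _].
    by rewrite !big_ord0 scaler0 addr0.
  by rewrite big_ord0 nrm0 mul0r.
have [C _ HC] := bounded_linear_bound IH; have [D _ HD] := bounded_linear_bound (fl N).
apply: (@bounded_linearI _ _ _ _ _ (C + D)) => [a x y _ _|x _].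
  by rewrite !big_ord_recr/= IH.1// (fl N).1// scalerDr addrACA.
rewrite big_ord_recr/=; apply: le_trans (nrmD _ _) _.
by rewrite mulrDl lerD ?HC ?HD.
Qed.

Lemma bounded_rank_one (H : hilbertType R) (W : normedModType R[i]) (y : H) (w : W) :
  bounded_linear_on setT (fun x => hdot x y *: w).
Proof.
apply: (@bounded_linearI _ _ _ _ _ (nrm y * nrm w)) => [a x z _ _|x _].
  by rewrite hdotPl scalerDl scalerA.
rewrite nrmZ mulrAC ler_wpM2r ?nrm_ge0// mulrC; exact: cauchy_schwarz.
Qed.

End Products.

(** * The biorthogonal sequence of a Schauder basis *)

Section Biorthogonal.
Context {R : realType}.

(** The n-th coordinate of z is read off from the difference of two successive
    partial sums, so it depends boundedly on z; Riesz turns it into y n.  A vector with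
    zero coordinates has zero partial sums, and the partial sums of any vector
    tend to it. *)
Lemma biorthogonal_exists (H : hilbertType R) (x : nat -> H) :
  closed_span (range x) = setT -> 0 < inf (range (fun n => nrm (x n))) ->
  bounded_partial_sums x ->
  exists (y : nat -> H) (K : R),
    [/\ 0 <= K, forall m n, hdot (x m) (y n) = (m == n)%:R, forall n, nrm (y n) <= K
      & forall z, (forall n, hdot z (y n) = 0) -> z = 0].
Proof.
move=> xT; set i := inf _ => i0 [P [Pl PE [C0 PC0]]].
have xi n : i <= nrm (x n).
  by apply: ge_inf; [exists 0 => _ [m _ <-]; exact: nrm_ge0 | exists n].
have [C C1 PC] : exists2 C : R, 0 <= C & forall n z, nrm (P n z) <= C * nrm z.
  exists `|C0| => // n z; have := PC0 n z; rewrite !nrmE -rmorphM /= lecR => /le_trans; apply.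
  by rewrite ler_wpM2r ?nrm_ge0// ler_norm.
have Px n k : P n (x k) = if (k <= n)%N then x k else 0.
  have := PE n k.+1 (fun j => (j == k)%:R).
  rewrite [X in P n X](_ : _ = x k) => [->|].
    rewrite big_mkcond big_ord_recr/= eqxx scale1r big1 ?add0r// => j _.
    by rewrite ltn_eqF// scale0r if_same.
  rewrite big_ord_recr/= eqxx scale1r big1 ?add0r// => j _.
  by rewrite ltn_eqF// scale0r.
(* Q n z is the n-th term of the expansion of z. *)
pose Q n z := P n z - (if n is m.+1 then P m z else 0).
have QC n z : nrm (Q n z) <= 2 * C * nrm z.
  apply: le_trans (nrmB _ _) _; rewrite -mulrA mulr_natl mulr2n lerD//.
  by case: n => [|n]; [rewrite nrm0 mulr_ge0 ?nrm_ge0 | exact: PC].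
have Qx n k : Q n (x k) = (k == n)%:R *: x n.
  rewrite /Q Px; case: n => [|n].
    by rewrite leqn0 subr0; case: eqP => [->|_]; rewrite ?scale1r ?scale0r.
  rewrite Px; case: (eqVneq k n.+1) => [->|kn].
    by rewrite leqnn ltnn subr0 scale1r.
  rewrite [(k <= n.+1)%N]leq_eqVlt (negbTE kn) /= ltnS scale0r.
  by case: ifP; rewrite subrr.
have Ql n (a : R[i]) u v : Q n (a *: u + v) = a *: Q n u + Q n v.
  rewrite /Q (Pl n).1//; case: n => [|n]; first by rewrite !subr0.
  by rewrite (Pl n).1// scalerBr opprD addrACA.
have x0 n : 0 < nrm (x n) by apply: lt_le_trans (xi n).
pose f n z := hdot (Q n z) (x n) / (nrm (x n) ^+ 2)%:C.
pose K := 2 * C / i.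
have K0 : 0 <= K by rewrite divr_ge0 ?mulr_ge0 ?(ltW i0).
have fK n z : nrm (f n z) <= K * nrm z.
  rewrite nrm_scalar /f normcM (_ : _^-1 = ((nrm (x n) ^+ 2)^-1)%:C); last by rewrite fmorphV.
  rewrite normc_realE.
  rewrite ger0_norm ?invr_ge0 ?sqr_ge0// ler_pdivrMr ?exprn_gt0//.
  apply: le_trans (cauchy_schwarz _ _) _.
  rewrite expr2 mulrA ler_wpM2r ?nrm_ge0//; apply: le_trans (QC _ _) _.
  have -> : 2 * C = K * i by rewrite divfK ?gt_eqF.
  rewrite -[K * i * _]mulrA -[K * _ * _]mulrA ler_wpM2l//.
  by rewrite mulrC ler_wpM2l ?nrm_ge0.
have fl n : bounded_linear_on setT (f n).
  apply: (@bounded_linearI _ _ _ _ _ K) => // a u v _ _.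
  by rewrite /f Ql hdotPl mulrDl -mulrA.
have /choice[y Hy] n : exists y, forall z, f n z = hdot z y.
  have [y [_ Hy]] := riesz_representation (@subspace_setT _ _) closedT (fl n).
  by exists y => z; exact: Hy.
have yx m n : hdot (x m) (y n) = (m == n)%:R.
  rewrite -Hy /f Qx hdotZl hdotxxE mulfK//.
  by apply: contraTneq (x0 n) => /(@complexI R _ 0)/eqP; rewrite sqrf_eq0 => /eqP ->; rewrite ltxx.
exists y, K; split=> // [n|z zy].
  have [->//|y0] := eqVneq (nrm (y n)) 0.
  have yp : 0 < nrm (y n) by rewrite lt_def y0 nrm_ge0.
  rewrite -(ler_pM2r yp) -expr2; apply: le_trans (fK n (y n)).
  by rewrite Hy hdotxxE nrm_scalar normc_realE ger0_norm ?sqr_ge0.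
have Pz N : P N z = 0.
  rewrite (@eq_on_closed_span _ _ _ _ _ (fun z => \sum_(k < N.+1) hdot z (y k) *: x k) xT (Pl N)).
  - by rewrite big1// => k _; rewrite zy scale0r.
  - by apply: (bounded_linear_sum N.+1 (fun k => bounded_rank_one (y k) (x k))).
  move=> _ [m _ <-]; rewrite Px; case: ifP => [mN|/negbT mN].
    rewrite (bigD1 (Ordinal (mN : (m < N.+1)%N)))//= yx eqxx scale1r big1 ?addr0// => k.
    by rewrite -val_eqE/= eq_sym yx => /negbTE ->; rewrite scale0r.
  rewrite big1// => k _; rewrite yx gtn_eqF ?scale0r//.
  by rewrite -ltnNge in mN; apply: leq_ltn_trans mN; rewrite -ltnS ltn_ord.
apply: nrm_le_eps => e e0.
have C2 : 0 < 1 + C by rewrite ltr_wpDr.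
have /closureP/(_ _ (divr_gt0 e0 C2))[s ss zs] : closed_span (range x) z by rewrite xT.
have [N PN] : exists N, forall n, (N <= n)%N -> P n s = s.
  have : linear_span (range x) `<=` [set s | exists N, forall n, (N <= n)%N -> P n s = s].
    apply: linear_span_min => [|_ [k _ <-]]; last by exists k => n kn; rewrite Px kn.
    split; first by exists 0%N => n _; rewrite (bounded_linear0 (@subspace_setT _ _) (Pl n)).
    move=> a u v [N1 H1] [N2 H2]; exists (maxn N1 N2) => n; rewrite geq_max => /andP[n1 n2].
    by rewrite (Pl n).1// H1// H2.
  by move=> /(_ _ ss).
rewrite (_ : z = (z - s) - P N (z - s)); last first.
  by rewrite (bounded_linearB (Pl N))// Pz PN// sub0r opprK subrK.
apply: le_trans (nrmB _ _) _; move: zs; rewrite ltr_pdivlMr// => /ltW; apply: le_trans.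
by rewrite mulrDr mulr1 lerD2l mulrC PC.
Qed.

End Biorthogonal.

(** * The Carleson condition *)

Section Carleson.
Context {R : realType}.

Lemma prod_1Dsum_le1 (d t : nat -> R) N :
  (forall k, 0 <= d k <= 1 - t k) -> (forall k, 0 <= t k) ->
  (\prod_(k < N) d k) * (1 + \sum_(k < N) t k) <= 1.
Proof.
move=> dt t0; elim: N => [|N IH]; first by rewrite !big_ord0 mul1r addr0.
rewrite !big_ord_recr/=; move: IH; set p := \prod_(_ < _) _; set s := \sum_(_ < _) _.
have p0 : 0 <= p by apply: prodr_ge0 => i _; case/andP: (dt i).
have s0 : 0 <= s by apply: sumr_ge0 => i _.
have /andP[d0 d1] := dt N; have tN := t0 N => IH.
have : d N * (1 + (s + t N)) <= 1 + s by nra.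
by move=> /(ler_wpM2l p0); rewrite mulrA => /le_trans; apply.
Qed.

(** The Carleson condition at the first point gives the Blaschke condition:
    there 1 - b_k >= 1 - lam k, and a product of factors 1 - t_k that stays above
    delta forces the sum of the t_k to stay below 1 / delta. *)
Lemma carleson_summable (lam : nat -> R) : (forall n, 0 < lam n < 1) ->
  {homo lam : m n / (m < n)%N >-> m < n} -> carleson (fun n => (lam n)%:C) ->
  exists C, forall n, series (fun k => 1 - lam k) n <= C.
Proof.
move=> lam01 homo [delta delta0 /(_ 0%N)]; rewrite /blaschke_except.
(* The condition omits the 0-th factor; it is replaced by 1 here. *)
pose d k := if k == 0%N then 1 else (lam k - lam 0%N) / (1 - lam k * lam 0%N).
pose t k := if k == 0%N then 0 else 1 - lam k.
pose p N := \prod_(k < N) d k.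
have dt k : 0 <= d k <= 1 - t k.
  rewrite /d /t; case: (posnP k) => [_|k0]; first by rewrite subr0 lexx ler01.
  have := homo _ _ k0; have /andP[] := lam01 k; have /andP[] := lam01 0%N.
  move: (lam k) (lam 0%N) => a b b0 b1 a0 a1 ba.
  have ab : 0 < 1 - a * b by nra.
  have a2b : 0 <= b * ((1 - a) * (1 + a)) by do 2?[apply: mulr_ge0]; lra.
  by apply/andP; split; [apply: divr_ge0; lra | rewrite ler_pdivrMr//; nra].
have t0 k : 0 <= t k.
  rewrite /t; case: eqP => // _; have /andP[_] := lam01 k; lra.
have pE : (fun N => \prod_(k < N | k != 0%N :> nat)
    blaschke_factor (lam k)%:C (lam 0%N)%:C) = fun N => (p N)%:C.
  apply/funext => N; rewrite rmorph_prod/= big_mkcond/=; apply: eq_bigr => k _.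
  rewrite /d; case: eqP => //= _; rewrite blaschke_factor_real; last by case/andP: (lam01 k).
  by rewrite rmorphM/= fmorphV/= !rmorphB/= rmorphM.
rewrite pE.
have p0 N : 0 <= p N by apply: prodr_ge0 => k _; case/andP: (dt k).
have pdec : nonincreasing_seq p.
  apply/nonincreasing_seqP => N; rewrite /p big_ord_recr/= ler_piMr// ?p0//.
  by case/andP: (dt N) => _ /le_trans; apply; have := t0 N; lra.
have pcv : cvgn p by apply: nonincreasing_is_cvgn => //; exists 0 => _ [N _ <-].
rewrite (_ : limn _ = (limn p)%:C); last first.
  apply: cvg_lim; first exact: norm_hausdorff.
  apply/cvg_nrmP; under eq_fun do rewrite -rmorphB/= nrm_scalar normc_realE.
  rewrite -[0](@normr0 _ R) -[in X in `|X|](subrr (limn p)); apply: cvg_norm.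
  by apply: cvgB => //; exact: cvg_cst.
have L0 : 0 <= limn p by apply: limr_ge => //; apply: nearW.
rewrite ger0_norm ?lecR// => dL.
exists (1 + delta^-1) => N.
have dp : delta <= p N by apply: le_trans dL (nonincreasing_cvgn_ge pdec pcv N).
have := @prod_1Dsum_le1 d t N dt t0; rewrite -/(p N) => H.
have s0 : 0 <= \sum_(k < N) t k by apply: sumr_ge0.
have sd : \sum_(k < N) t k <= delta^-1.
  rewrite -[leRHS]mul1r ler_pdivlMr//; nra.
apply: (@le_trans _ _ (1 + \sum_(k < N) t k)); last by rewrite lerD2l.
case: N {dp H s0 sd} => [|N].
  by rewrite [series _ _]big_geq// big_ord0 addr0 ler01.
rewrite /series /= big_mkord !big_ord_recl/= add0r lerD//.
by have /andP[/ltW] := lam01 0%N; lra.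
Qed.

End Carleson.

(** * The second component of the intertwining operator *)

Section SzegoVectors.
Context {R : realType}.
Variable lam : nat -> R.
Hypothesis lam01 : forall n, 0 < lam n < 1.
Let l n : R[i] := (lam n)%:C.
Let u n : hardy R := normalized_szego (l n).

Let l_lt1 n : `|l n| < 1.
Proof. by rewrite -normc_lt1 normc_realE gtr0_norm; case/andP: (lam01 n). Qed.


Let w2_gt0 n : 0 < 1 - normc (l n) ^+ 2.
Proof. by rewrite subr_gt0 expr_lt1 ?normc_ge0// normc_lt1. Qed.

Lemma hdot_normalized_szego (h : hardy R) n :
  hdot h (u n) = (Num.sqrt (1 - normc (l n) ^+ 2))%:C * h (l n).
Proof.
rewrite /u /normalized_szego hdotZr hardy_val_dot//.
by congr (_ * _); rewrite /= oppr0.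
Qed.

Lemma hdot_normalized_szego_eq0 (h : hardy R) n : hdot h (u n) = 0 -> h (l n) = 0.
Proof.
rewrite hdot_normalized_szego => /eqP; rewrite mulf_eq0 => /orP[|/eqP//].
by rewrite (inj_eq (@complexI _) _ 0) sqrtr_eq0 leNgt w2_gt0.
Qed.

Lemma nrm_normalized_szego n : nrm (u n) = 1.
Proof.
apply/eqP; rewrite -(@eqrXn2 _ 2)// ?nrm_ge0// expr1n /u /normalized_szego nrmZ.
rewrite normc_realE ger0_norm ?sqrtr_ge0// exprMn sqr_sqrtr ?(ltW (w2_gt0 n))//.
by rewrite nrm_szego// divff// gt_eqF.
Qed.

Lemma hdot_shift_normalized_szego (h : hardy R) n :
  hdot (hardy_shift h) (u n) = l n * hdot h (u n).
Proof. by rewrite !hdot_normalized_szego hardy_shiftE// mulrCA. Qed.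

Lemma hdot_normalized_szego_le (h : hardy R) n : normc (hdot h (u n)) <= nrm h.
Proof. by apply: le_trans (cauchy_schwarz _ _) _; rewrite nrm_normalized_szego mulr1. Qed.

(** The vector is the sum of (1 - lam n) <h, u n> y n, which converges absolutely
    because the u n are unit vectors and the 1 - lam n are summable. *)
Lemma weighted_series_exists (H : hilbertType R) (x y : nat -> H) (K : R) :
  (exists C, forall n, series (fun k => 1 - lam k) n <= C) -> 0 <= K ->
  (forall m n, hdot (x m) (y n) = (m == n)%:R) -> (forall n, nrm (y n) <= K) ->
  exists C : R, forall h : hardy R, exists v,
    (forall m, hdot v (x m) = (1 - lam m)%:C * hdot h (u m)) /\ nrm v <= C * nrm h.
Proof.
move=> [C HC] K0 xy yK; exists (C * K) => h.
pose v n := ((1 - lam n)%:C * hdot h (u n)) *: y n.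
have lam1 n : 0 <= 1 - lam n by case/andP: (lam01 n) => _ /ltW; rewrite subr_ge0.
have vt n : nrm (v n) <= (1 - lam n) * (nrm h * K).
  rewrite nrmZ normcM normc_realE ger0_norm// -mulrA ler_wpM2l//.
  by apply: ler_pM; rewrite ?normc_ge0 ?nrm_ge0 ?hdot_normalized_szego_le.
have tC n : series (fun n => (1 - lam n) * (nrm h * K)) n <= C * K * nrm h.
  rewrite /series /= -mulr_suml -mulrA [K * _]mulrC ler_wpM2r ?HC//.
  by rewrite mulr_ge0 ?nrm_ge0.
have [vcv vC] := nrm_series vt tC.
exists (limn (series v)); split => // m.
have Hm := @cvg_hdotl _ _ _ _ (x m) vcv; apply: (cvg_unique (@norm_hausdorff _ _) Hm).
apply/cvg_nrmP; apply/cvgrPdist_lt => e e0; exists m.+1 => // N /= mN.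
have -> : hdot (series v N) (x m) = \sum_(0 <= k < N) hdot (v k) (x m).
  rewrite /series /=; elim/big_rec2: _ => [|k a b _ <-]; first exact: hdot0l.
  by rewrite hdotDl.
rewrite (bigD1_seq m) ?mem_index_iota ?iota_uniq//= big1 => [|k km].
  by rewrite addr0 /v hdotZl (hdotC (x m)) xy eqxx rmorph1 mulr1 subrr nrm0 subrr normr0.
by rewrite /v hdotZl (hdotC (x m)) xy eq_sym (negbTE km) rmorph0 mulr0.
Qed.

End SzegoVectors.

(** * The invariant subspace *)

Unset Implicit Arguments.

Theorem corollary2p14 (R : realType) (lam : nat -> R) (H0 : hilbertType R)
  (x : nat -> H0) (W : hardy R -> H0) (g : R[i] -> R[i]) (R0 : H0 -> H0) :
  let l := fun n => (lam n)%:C in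
  (forall n, 0 < lam n < 1) ->
  (forall n, lam n < lam n.+1) ->
  carleson l ->
  finitely_independent x ->
  closed_span (range x) = setT ->
  0 < inf (range (fun n => complex.Re `|x n|)) ->
  bounded_partial_sums x ->
  bounded_linear_on (KB l) W ->
  (forall n, W (normalized_szego (l n)) = x n) ->
  ~ riesz_basis x ->
  Hinfty g ->
  outer g ->
  square_summable (fun n => g (l n)) ->
  bounded_linear_on setT R0 ->
  (forall n, R0 (x n) = l n *: x n) ->
  let T := opT l W R0 in
  exists M : set (hardy R * H0),
    [/\ subspace_set M /\ closed M,
        M `<=` BH2 l `*` setT,
        (forall p, M p -> M (T p)),
        similar_on M T setT (@hardy_shift R)
      & closed_span ((BH2 l `*` [set 0]) `|` M) = BH2 l `*` setT].
Proof.
move=> l lam01 inc car _ xT xinf xps Wl Wu _ _ _ _ R0l R0x T.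
have homo : {homo lam : m n / (m < n)%N >-> m < n}.
  by apply: homo_ltn => // y a b; exact: lt_trans.
have inj : injective lam.
  move=> m n mn; case: (ltngtP m n) => // /homo; by rewrite mn ltxx.
have sum := carleson_summable lam01 homo car.
have iB := isometric_blaschke lam01 sum; rewrite -/l in iB.
have sB := subspace_BH2 l.
have cB := closed_BH2 lam01 sum; rewrite -/l in cB.
have sK : subspace_set (KB l) by exact: subspace_orthocompl.
have cK : closed (KB l) by exact: closed_orthocompl.
pose u n : hardy R := normalized_szego (l n).
have Bu (k : hardy R) n : BH2 l k -> hdot k (u n) = 0.
  move=> [f Hf]; rewrite (hdot_normalized_szego lam01) Hf; last first.
    by rewrite -normc_lt1 normc_realE gtr0_norm; case/andP: (lam01 n).
  by rewrite (blaschke_zero lam01 sum) mul0r mulr0.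
have uK n : KB l (u n) by move=> k Bk; apply: hdot_eq0C; exact: Bu.
have [y [K [K0 xy yK y0]]] := biorthogonal_exists xT xinf xps.
have [C /choice[Z2 HZ2]] := weighted_series_exists lam01 sum K0 xy yK.
have Z2x h m : hdot (Z2 h) (x m) = (1 - lam m)%:C * hdot h (u m) by case: (HZ2 h) => + _; apply.
have x_sep a b : (forall m, hdot a (x m) = hdot b (x m)) -> a = b.
  move=> ab; apply/eqP; rewrite -subr_eq0; apply/eqP/(orthogonal_to_total xT) => _ [m _ <-].
  by apply: hdot_eq0C; rewrite hdotBl ab subrr.
(* Linear because the inner products with the total family x determine Z2 h. *)
have Z2l : bounded_linear_on setT Z2.
  apply: (@bounded_linearI _ _ _ _ _ C) => [a h k _ _|h _]; last by case: (HZ2 h).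
  by apply: x_sep => m; rewrite hdotPl !Z2x hdotPl; ring.
pose adj := adjoint_on (KB l) W.
have adjK v : KB l (adj v) by case: (adjoint_onP v sK cK Wl).
have adju v n : hdot (adj v) (u n) = hdot v (x n).
  have [_ Hv] := adjoint_onP v sK cK Wl.
  by rewrite hdotC -Hv// Wu -hdotC.
pose V := mult (blaschke l).
have VB h : BH2 l (V h) by exact: BH2_mult.
(* The constant 3 exceeds the bound 2 for multiplication by 1 - z. *)
pose phi (h : hardy R) : hardy R := h - hardy_shift h + (3%:C : R[i]) *: V h.
have phil a h k : phi (a *: h + k) = a *: phi h + phi k.
  apply: hardy_ext => z z1; rewrite /phi /V.
  rewrite !(hardy_val_lin, hardy_valD, hardy_valN, hardy_valZ)// !hardy_shiftE// !mult_val//.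
  rewrite !hardy_val_lin//; ring.
have phiS h : phi (hardy_shift h) = hardy_shift (phi h).
  apply: hardy_ext => z z1; rewrite /phi /V.
  rewrite !(hardy_valD, hardy_valN, hardy_valZ, hardy_shiftE, mult_val)//; ring.
have n3 h : nrm (3%:C *: V h) = 3 * nrm h.
  by rewrite nrmZ normc_realE ger0_norm// nrm_mult.
have phi_ge h : nrm h <= nrm (phi h).
  have := nrmB (phi h) (h - hardy_shift h); rewrite /phi addrC addKr n3 => H1.
  have := nrmB h (hardy_shift h); rewrite nrm_hardy_shift; lra.
have phi_le h : nrm (phi h) <= 5 * nrm h.
  have := nrmD (h - hardy_shift h) (3%:C *: V h); rewrite n3 => H1.
  have := nrmB h (hardy_shift h); rewrite nrm_hardy_shift; rewrite /phi; lra.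
pose Z1 h := orthoproj (BH2 l) (phi h).
have Z1B h : BH2 l (Z1 h) by case: (orthoprojP (phi h) sB cB).
have Z1K h : KB l (phi h - Z1 h) by case: (orthoprojP (phi h) sB cB).
have Z1l : bounded_linear_on setT Z1.
  apply: (@bounded_linearI _ _ _ _ _ 5) => [a h k _ _|h _].
    by rewrite /Z1 phil orthoproj_lin.
  exact: le_trans (nrm_orthoproj _ sB cB) (phi_le h).
(* Both sides lie in K_B and have the inner product (1 - lam n) <h, u n> with u n. *)
have key h : adj (Z2 h) = phi h - Z1 h.
  apply/eqP; rewrite -subr_eq0; apply/eqP; apply: (KB_vanish lam01 sum inj).
    exact: subspaceB sK (adjK _) (Z1K _).
  move=> n; apply: (hdot_normalized_szego_eq0 lam01).
  rewrite hdotBl adju Z2x hdotBl (Bu (Z1 h))// subr0 /phi hdotDl hdotBl hdotZl (Bu (V h))//.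
  rewrite (hdot_shift_normalized_szego lam01) rmorphB; ring.
have [Cw Cw0 HCw] := nrm_adjoint_on sK cK Wl.
have Z_ge h : nrm h <= (1 + Cw) * nrm (Z1 h, Z2 h).
  have [p1 p2 _] := nrm_pair (Z1 h, Z2 h).
  apply: le_trans (phi_ge h) _; rewrite mulrDl mul1r -[phi h](subrK (Z1 h)) -key addrC.
  apply: le_trans (nrmD _ _) _; rewrite lerD//; apply: le_trans (HCw _) _.
  by rewrite ler_wpM2l// ltW.
have TZ h : T (Z1 h, Z2 h) = (Z1 (hardy_shift h), Z2 (hardy_shift h)).
  rewrite /T /opT /=; congr pair.
    rewrite -/adj -/(adj _) key; set q := hardy_shift (phi h - Z1 h).
    have [Bq qK] := orthoprojP q sB cB; apply/esym; apply: (orthoproj_eq sB cB).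
      exact: (subspaceD sB (BH2_shift (Z1B h)) Bq).
    have -> : phi (hardy_shift h) = hardy_shift (Z1 h) + q.
      by rewrite phiS /q -(bounded_linearD (@hardy_shift_bounded R))// addrC subrK.
    by rewrite opprD addrACA subrr add0r.
  apply: x_sep => m; have [_ Hv] := adjoint_onP (Z2 h) (@subspace_setT _ _) closedT R0l.
  have lC q : (l m * q)^*%C = l m * q^*%C.
    by rewrite rmorphM; congr (_ * _); rewrite /l /= oppr0.
  rewrite hdotC -Hv// R0x hdotZl lC -hdotC !Z2x.
  by rewrite (hdot_shift_normalized_szego lam01) mulrCA.
apply: (intertwiner_range sB cB Z1l Z2l Z1B Z_ge TZ).
apply: closed_subspace_full => [||z zZ].
- apply: closed_subspace_closure; split.
    by exists 0 => //; exact: (bounded_linear0 (@subspace_setT _ _) Z2l).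
  by move=> a _ _ [h _ <-] [k _ <-]; exists (a *: h + k) => //; rewrite Z2l.1.
- exact: closed_closure.
(* As adj (y m) is biorthogonal to the u n, only the m-th term of Z2 survives. *)
apply: y0 => m; have Zy : Z2 (adj (y m)) = (1 - lam m)%:C *: y m.
  apply: x_sep => n; rewrite Z2x adju hdotZl (hdotC (x n)) xy.
  by case: eqP => [->|_]; rewrite ?rmorph0 ?mulr0.
have : hdot z (Z2 (adj (y m))) = 0.
  by apply: zZ; apply: subset_closure; exists (adj (y m)).
rewrite Zy hdotZr => /eqP; rewrite mulf_eq0 => /orP[|/eqP//].
rewrite conjc_eq0 (inj_eq (@complexI _) _ 0) subr_eq0 => /eqP E.
by have /andP[_] := lam01 m; rewrite -E ltxx.
Qed.
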